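(* For $n\ge1$ let $$\nu_{n,1}=\frac1n\sum_{\{z\,:\,T_n^{w_1}(z)=0\}}\delta_z,$$ where the sum is over all zeros of $T_n^{w_1}$ counted with multiplicity. Then for every $0<r<1$, $$\nu_{n,1}\big(\{z\in\mathbb{C}:|z|\le r\}\big)\to0\quad\text{as } n\to\infty.$$ Moreover, $\nu_{n,1}$ converges in the weak-star sense to the normalised Lebesgue measure $\frac{d\theta}{2\pi}$ on the unit circle $\mathbb{T}$ as $n\to\infty$.
   Context: $\mathbb{T}$ is the unit circle and $\delta_z$ the Dirac measure at $z$. $T_n^{w_1}$ is the unique monic polynomial of degree $n$ with complex coefficients attaining $\min_{a_1,\dots,a_n\in\mathbb{C}}\max_{z\in\mathbb{T}}\left|(z-1)\prod_{k=1}^n(z-a_k)\right|$ (the weighted Chebyshev polynomial on $\mathbb{T}$ for the weight $|w_1(z)|=|z-1|$). Weak-star convergence $\nu_n\to\nu$ means $\int\varphi\,d\nu_n\to\int\varphi\,d\nu$ for every continuous compactly supported $\varphi:\mathbb{C}\to\mathbb{C}$. *)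

(* Defs.v *)
From HB Require Import structures.
From mathcomp Require Import all_boot all_order all_algebra.
From mathcomp Require Import complex.
From mathcomp Require Import all_classical all_reals all_analysis.
From mathcomp Require Import measurable_realfun.

Set Implicit Arguments.
Unset Strict Implicit.
Unset Printing Implicit Defensive.

Import Order.TTheory GRing.Theory Num.Theory.
Import numFieldNormedType.Exports.
Import ComplexField.Normc.

Local Open Scope classical_set_scope.
Local Open Scope complex_scope.
Local Open Scope ring_scope.

(* R[i] gets the topology of the norm it carries as a numFieldType, and the
   corresponding Borel sigma-algebra. *)
Set Warnings "-redundant-canonical-projection".
HB.instance Definition _ (R : realType) := NormedModule.copy R[i] (R[i]^o).

Definition borelC (R : realType) : set (set R[i]) :=
  <<s [set A : set R[i] | open A] >>.

HB.instance Definition _ (R : realType) :=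
  @isMeasurable.Build default_measure_display R[i] (@borelC R)
    (@measurable0 _ (g_sigma_algebraType [set A : set R[i] | open A]))
    (@measurableC _ (g_sigma_algebraType [set A : set R[i] | open A]))
    (@bigcupT_measurable _ (g_sigma_algebraType [set A : set R[i] | open A])).

Set Warnings "redundant-canonical-projection".

Definition unit_circle (R : realType) : set R[i] := [set z | normc z = 1].
Arguments unit_circle : clear implicits.

(* The supremum is a maximum as soon as w is continuous, the circle being
   compact. *)
Definition weighted_norm (R : realType) (w : R[i] -> R[i]) (p : {poly R[i]}) : R :=
  sup [set normc (w z * p.[z]) | z in unit_circle R].

Definition weighted_chebyshev (R : realType) (w : R[i] -> R[i]) (n : nat)
    (p : {poly R[i]}) : Prop :=
  [/\ p \is monic, size p = n.+1 &
      forall a : 'I_n -> R[i],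
        weighted_norm w p <= weighted_norm w (\prod_(k < n) ('X - (a k)%:P))].

Definition w1 (R : realType) (z : R[i]) : R[i] := z - 1.

(* The zeros of p, each repeated according to its multiplicity. *)
Definition zeros (R : realType) (p : {poly R[i]}) : seq R[i] :=
  sval (closed_field_poly_normal p).

Definition zero_measure (R : realType) (n : nat) (p : {poly R[i]}) :
    {measure set R[i] -> \bar R} :=
  mscale (n%:R^-1)%:nng
    (msum (fun k => \d_((zeros p)`_k) : {measure set R[i] -> \bar R})
          (size (zeros p))).

Definition cis (R : realType) (t : R) : R[i] := cos t +i* sin t.

Lemma continuous_cis (R : realType) : continuous (@cis R).
Proof.
move=> t; apply/cvgrPdist_lt => /= e; case: e => e i /andP[/eqP/= -> e0].
have e2 : 0 < e / 2 by rewrite divr_gt0.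
have /cvgrPdist_lt /(_ _ e2) ct := @continuous_cos R t.
have /cvgrPdist_lt /(_ _ e2) st := @continuous_sin R t.
near=> u.
have cu : `|cos t - cos u| < e / 2 by near: u; exact: ct.
have su : `|sin t - sin u| < e / 2 by near: u; exact: st.
rewrite /cis; simpc => /=.
move: (cos t - cos u) (sin t - sin u) cu su => a b cu su.
apply: le_lt_trans (_ : `|a| + `|b| < e); last first.
  by rewrite [e]splitr ltrD.
rewrite -[leRHS]ger0_norm ?addr_ge0// -sqrtr_sqr ler_sqrt ?sqr_ge0//.
by rewrite sqrrD !real_normK ?num_real// addrAC lerDl mulrn_wge0// mulr_ge0.
Unshelve. all: by end_near. Qed.

Lemma measurable_cis (R : realType) :
  @measurable_fun _ _ (measurableTypeR R) R[i] setT (@cis R).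
Proof.
apply: (measurability [set A : set R[i] | open A]) => //.
move=> _ [A oA <-]; rewrite setTI.
apply: open_measurable; apply: open_comp => // t _.
exact: continuous_cis.
Qed.

Definition cis_mfun (R : realType) : {mfun measurableTypeR R >-> R[i]} :=
  HB.pack (@cis R) (@isMeasurableFun.Build _ _ (measurableTypeR R) R[i]
    (@cis R) (@measurable_cis R)).

Lemma two_pi_gt0 (R : realType) : 0 < 2 * pi :> R.
Proof. exact: mulr_gt0 (ltr0Sn R 1) (pi_gt0 R). Qed.

(* d\theta / 2\pi: the image of the uniform probability on [0, 2\pi] under
   \theta |-> e^(i \theta). *)
Definition circle_measure (R : realType) : {measure set R[i] -> \bar R} :=
  distribution (uniform_prob (two_pi_gt0 R)) (@cis_mfun R).
Arguments circle_measure : clear implicits.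

Definition cintegral (R : realType) (mu : {measure set R[i] -> \bar R})
    (f : R[i] -> R[i]) : R[i] :=
  (\int[mu]_z complex.Re (f z)) +i* (\int[mu]_z complex.Im (f z)).

Definition weak_star_cvg (R : realType)
    (nu : nat -> {measure set R[i] -> \bar R})
    (mu : {measure set R[i] -> \bar R}) : Prop :=
  forall phi : R[i] -> R[i],
    continuous phi -> compact (closure [set z | phi z != 0]) ->
    cintegral (nu n) phi @[n --> \oo] --> cintegral mu phi.

(* Main.v *)
Require Import Defs.
From mathcomp Require Import all_boot all_order all_algebra.
From mathcomp Require Import complex.
From mathcomp Require Import all_classical all_reals all_analysis.
From mathcomp Require Import measurable_realfun.
From mathcomp Require Import cyclic separable cyclotomic polyrcf.
From mathcomp Require Import ring lra zify.
Import Order.TTheory GRing.Theory Num.Theory.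
Import numFieldNormedType.Exports.
Import ComplexField.Normc.

Set Implicit Arguments.
Unset Strict Implicit.
Unset Printing Implicit Defensive.
Local Open Scope classical_set_scope.
Local Open Scope ring_scope.

(* Let M_n be the minimum of max |(z - 1) p(z)| over the monic p of degree n, and
   K = n + 2.  For P monic of degree n + 1 with P(1) = 0, the half-angle
   symmetrisation of z ^ (- n / 2) P(z) at z = exp (2 i t) is a real polynomial
   in y = cos t of degree K, with leading coefficient 2 ^ (K - 1) and zeros at
   1 and -1.  Comparing it with T_K (c y) / c ^ K, where c = cos (pi / 2K),
   Chebyshev's alternation argument gives M_n >= c ^ (- K), and a polynomial
   built by a three-term recurrence attains this value.

   If p is extremal of degree n, then (p - p(0)) / z competes in degree n - 1,
   so that 2 |p(0)| >= M_(n-1) - M_n >= 1 / (2 K ^ 4).  As the Mahler measure of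
   p is at most M_n <= 2, this polynomial lower bound on the product of the
   zeros leaves only O(log n) zeros outside any annulus r < |z| < 1 / r.
   Finally, the coefficients of (z - 1) p are bounded by 2, so by Newton's
   identities each power sum of the zeros is bounded independently of n; the
   moments of the zero measures thus tend to 0, and Fejer's kernel concludes. *)

(** * The modulus of complex numbers and the parametrisation [cis] of the circle *)

Section Normc.
Context {R : realType}.
Implicit Types z w : R[i].

Lemma normc_ge0 z : 0 <= normc z.
Proof. by case: z => a b; exact: sqrtr_ge0. Qed.

Lemma normcX z n : normc (z ^+ n) = normc z ^+ n.
Proof. by elim: n => [|n IH]; rewrite ?normc1// !exprS normcM IH. Qed.

Lemma normc_sum I (r : seq I) (P : pred I) (F : I -> R[i]) :
  normc (\sum_(i <- r | P i) F i) <= \sum_(i <- r | P i) normc (F i).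
Proof.
elim/big_ind2 : _ => [|x1 x2 y1 y2 h1 h2|//]; first by rewrite normc0.
by rewrite (le_trans (le_normcD _ _))// lerD.
Qed.

Lemma normc_prod I (r : seq I) (P : pred I) (F : I -> R[i]) :
  normc (\prod_(i <- r | P i) F i) = \prod_(i <- r | P i) normc (F i).
Proof.
by elim/big_ind2 : _ => [|x1 x2 y1 y2 <- <-|//]; rewrite ?normc1 ?normcM.
Qed.

Lemma normc_real (x : R) : normc x%:C%C = `|x|.
Proof. by rewrite /normc/= expr0n/= addr0 sqrtr_sqr. Qed.

Lemma normc_nat n : normc (n%:R : R[i]) = n%:R.
Proof. by rewrite -(rmorph_nat (real_complex R)) normc_real ger0_norm. Qed.

Lemma normcN z : normc (- z) = normc z.
Proof. by case: z => a b; rewrite /normc/= !sqrrN. Qed.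

Lemma normc_distC z w : normc (z - w) = normc (w - z).
Proof. by rewrite -normcN opprB. Qed.

Lemma normc_eq0 z : (normc z == 0) = (z == 0).
Proof. by apply/eqP/eqP => [/eq0_normc//|->]; exact: normc0. Qed.

Lemma normc_conj z : normc (z^*)%C = normc z.
Proof. by case: z => a b; rewrite /normc/= sqrrN. Qed.

Lemma le_dist_normc z w : normc z - normc w <= normc (z - w).
Proof. by rewrite lerBlDr -{1}(subrK w z) le_normcD. Qed.

Lemma le_Re_normc z : `|complex.Re z| <= normc z.
Proof.
case: z => a b /=; rewrite -sqrtr_sqr ler_wsqrtr//.
by rewrite lerDl sqr_ge0.
Qed.

Lemma le_Im_normc z : `|complex.Im z| <= normc z.
Proof.
case: z => a b /=; rewrite -sqrtr_sqr ler_wsqrtr//.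
by rewrite lerDr sqr_ge0.
Qed.

Lemma sqr_normcE z : normc z ^+ 2 = complex.Re z ^+ 2 + complex.Im z ^+ 2.
Proof. by case: z => a b /=; rewrite sqr_sqrtr// addr_ge0 ?sqr_ge0. Qed.

Lemma mulcJ_normc z : z * (z^*)%C = (normc z ^+ 2)%:C%C.
Proof.
by rewrite sqr_normcE; case: z => a b; simpc; rewrite -!expr2 [b * a]mulrC addNr.
Qed.

Lemma complexReM z w : complex.Re (z * w) =
  complex.Re z * complex.Re w - complex.Im z * complex.Im w.
Proof. by case: z => a b; case: w => c d. Qed.

Lemma complexReD z w : complex.Re (z + w) = complex.Re z + complex.Re w.
Proof. by case: z => a b; case: w => c d. Qed.

Lemma Re_sum I (r : seq I) (P : pred I) (F : I -> R[i]) :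
  complex.Re (\sum_(i <- r | P i) F i) = \sum_(i <- r | P i) complex.Re (F i).
Proof. by elim/big_ind2 : _ => // x1 x2 y1 y2 <- <-; rewrite complexReD. Qed.

Lemma Re_realM (x : R) z : complex.Re (x%:C%C * z) = x * complex.Re z.
Proof. by rewrite complexReM/= mul0r subr0. Qed.

Lemma circle_neq0 z : normc z = 1 -> z != 0.
Proof. by rewrite -normc_eq0 => ->; rewrite oner_eq0. Qed.

Lemma normc_cis (t : R) : normc (cis t) = 1.
Proof. by rewrite /normc/= cos2Dsin2 sqrtr1. Qed.

Lemma cisD (s t : R) : cis (s + t) = cis s * cis t.
Proof. by rewrite /cis cosD sinD; simpc; congr Complex; ring. Qed.

Lemma cisMn (t : R) n : cis (t *+ n) = cis t ^+ n.
Proof.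
elim: n => [|n IH]; first by rewrite mulr0n expr0 /cis cos0 sin0.
by rewrite mulrS cisD IH exprS.
Qed.

Lemma cisN (t : R) : cis (- t) = (cis t)^*%C.
Proof. by rewrite /cis cosN sinN. Qed.

Lemma cis_surj z : normc z = 1 ->
  exists2 t : R, 0 <= t <= 2 * pi & cis t = z.
Proof.
case: z => a b z1.
have /= ab : a ^+ 2 + b ^+ 2 = 1 by rewrite -(sqr_normcE (a +i* b)%C) z1 expr1n.
have a1 : -1 <= a <= 1.
  by rewrite -ler_norml -(@ler_sqr _ `|a|) ?nnegrE//
    expr1n real_normK ?num_real// -ab lerDl sqr_ge0.
have ha : Num.sqrt (1 - a ^+ 2) = `|b| by rewrite -ab addrAC subrr add0r sqrtr_sqr.
have acos0 := acos_ge0 a1; have acospi := acos_lepi a1.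
have [b0|b0] := leP 0 b.
  exists (acos a); first by rewrite acos0/= (le_trans acospi)// ler_peMl ?pi_ge0 ?ler1n.
  by rewrite /cis acosK ?in_itv//= sin_acos// ha ger0_norm.
exists (2 * pi - acos a).
  rewrite subr_ge0 lerBlDr lerDl acos0 andbT (le_trans acospi)//.
  by rewrite ler_peMl ?pi_ge0 ?ler1n.
rewrite /cis cosB sinB mulr_natl cos2pi sin2pi acosK ?in_itv//= sin_acos// ha ltr0_norm//.
by congr Complex; ring.
Qed.

Lemma horner_normc_le (p : {poly R[i]}) z : normc z = 1 ->
  normc p.[z] <= \sum_(i < size p) normc p`_i.
Proof.
move=> z1; rewrite horner_coef (le_trans (normc_sum _ _ _))//.
by apply: ler_sum => i _; rewrite normcM normcX z1 expr1n mulr1.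
Qed.

End Normc.

(** * Discrete Fourier analysis at roots of unity *)

Section DiscreteFourier.
Context {R : realType}.
Implicit Types z w : R[i].

(** ['X^n - 1] splits and is separable, so it has [n] distinct roots, and a primitive one among
    them. *)
Lemma prim_root_complex n : (0 < n)%N -> exists w : R[i], n.-primitive_root w.
Proof.
move=> n0; have [r] := closed_field_poly_normal ('X^n - 1 : {poly R[i]}).
rewrite lead_coefXnsubC// scale1r => rE.
have : has n.-primitive_root r.
  apply: has_prim_root => //.
  - by apply/allP => z; rewrite -root_prod_XsubC -rE.
  - by rewrite -separable_prod_XsubC -rE separable_Xn_sub_1// pnatr_eq0 -lt0n.
  - by rewrite -ltnS -(size_prod_XsubC r id) -rE size_XnsubC.
by case/hasP => w _ pw; exists w.
Qed.

Lemma sum_prim_root_expr n w m : n.-primitive_root w ->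
  \sum_(j < n) (w ^+ j) ^+ m = if (n %| m)%N then n%:R else 0.
Proof.
move=> pw; case: ifPn => nm.
  rewrite (eq_bigr (fun=> 1)) ?sumr_const ?card_ord// => j _.
  by rewrite exprAC -(prim_expr_mod pw) (eqP nm) expr1n.
have wm1 : w ^+ m - 1 != 0 by rewrite subr_eq0 -(prim_order_dvd pw).
apply: (mulfI wm1); rewrite mulr0 (eq_bigr (fun j : 'I_n => (w ^+ m) ^+ j)).
  by rewrite -subrX1 exprAC (prim_expr_order pw) expr1n subrr.
by move=> j _; rewrite exprAC.
Qed.

(** Orthogonality of characters; the exponent [n - l] stands for [- l], since [w ^+ n = 1]. *)
Lemma dft_coef n w (p : {poly R[i]}) l :
  n.-primitive_root w -> (size p <= n)%N -> (l < n)%N ->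
  \sum_(j < n) p.[w ^+ j] * (w ^+ j) ^+ (n - l) = n%:R * p`_l.
Proof.
move=> pw sp ln.
under eq_bigr do rewrite (horner_coef_wide _ sp) mulr_suml.
rewrite exchange_big/= (bigD1 (Ordinal ln))//= [X in _ + X]big1 ?addr0.
  rewrite -[LHS](@eq_bigr _ _ _ _ _ _ (fun j : 'I_n => p`_l * (w ^+ j) ^+ n)).
    by rewrite -mulr_sumr sum_prim_root_expr// dvdnn mulrC.
  by move=> j _; rewrite -mulrA -exprD subnKC ?(ltnW ln).
move=> i; rewrite -val_eqE/= => il.
rewrite (eq_bigr (fun j : 'I_n => p`_i * (w ^+ j) ^+ (i + (n - l)))); last first.
  by move=> j _; rewrite -mulrA -exprD.
rewrite -mulr_sumr sum_prim_root_expr// ifF ?mulr0//.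
(* [i + (n - l)] lies strictly between [0] and [2 n], so if [n] divides it then [i = l]. *)
apply/negbTE; apply: contra il => /dvdnP[k Hk].
have := ltn_ord i; move=> i_n; case: k Hk => [|[|k]] Hk; nia.
Qed.

Lemma normc_prim_root n w : n.-primitive_root w -> normc w = 1.
Proof.
move=> pw; have n0 := prim_order_gt0 pw.
apply/eqP; rewrite -(@pexpr_eq1 _ _ n)// ?normc_ge0// -normcX.
by rewrite (prim_expr_order pw) normc1.
Qed.

(** Cauchy's estimate, with the integral over the circle replaced by the average over the roots of
    unity of order [size p]. *)
Lemma normc_coef_le (p : {poly R[i]}) B l :
  (forall z, normc z = 1 -> normc p.[z] <= B) -> normc p`_l <= B.
Proof.
move=> pB; have B0 : 0 <= B by apply: le_trans (pB 1 _); rewrite ?normc_ge0 ?normc1.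
have [lp|lp] := leqP (size p) l; first by rewrite nth_default ?normc0.
have n0 : (0 < size p)%N by exact: leq_trans lp.
have [w pw] := prim_root_complex n0.
rewrite -(@ler_pM2l _ (size p)%:R) ?ltr0n//.
rewrite -{1}normc_nat -normcM -(dft_coef pw)//.
rewrite (le_trans (normc_sum _ _ _))// mulr_natl -[X in _ *+ X]card_ord -sumr_const.
apply: ler_sum => j _; rewrite normcM !normcX (normc_prim_root pw) !expr1n mulr1.
by apply: pB; rewrite normcX (normc_prim_root pw) expr1n.
Qed.

End DiscreteFourier.

(** * Chebyshev polynomials of the first kind *)

Section Chebyshev.
Context {R : realType}.

Fixpoint cheb_pair n : {poly R} * {poly R} :=
  if n is n'.+1 then
    ((cheb_pair n').2, 'X * (cheb_pair n').2 *+ 2 - (cheb_pair n').1)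
  else (1, 'X).

Definition cheb n := (cheb_pair n).1.

Lemma chebSS n : cheb n.+2 = 'X * cheb n.+1 *+ 2 - cheb n.
Proof. by []. Qed.

Lemma cosMSS (t : R) n :
  cos (t *+ n.+2) = cos t * cos (t *+ n.+1) *+ 2 - cos (t *+ n).
Proof.
rewrite [t *+ n.+2]mulrS cosD [t *+ n.+1]mulrS sinD cosD.
have := cos2Dsin2 t; move: (cos t) (sin t) (cos (t *+ n)) (sin (t *+ n)) => c s a b cs.
transitivity (c * (c * a - s * b) *+ 2 - (c ^+ 2 + s ^+ 2) * a); first by ring.
by rewrite cs mul1r; ring.
Qed.

Lemma horner_cheb n (t : R) : (cheb n).[cos t] = cos (t *+ n).
Proof.
suff: (cheb n).[cos t] = cos (t *+ n) /\ (cheb n.+1).[cos t] = cos (t *+ n.+1).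
  by case.
elim: n => [|n [IH1 IH2]].
  by rewrite /cheb/= hornerC hornerX mulr0n cos0 mulr1n.
by split => //; rewrite chebSS cosMSS !hornerE IH1 IH2.
Qed.

Lemma size_cheb n : (size (cheb n) <= n.+1)%N.
Proof.
suff: (size (cheb n) <= n.+1)%N /\ (size (cheb n.+1) <= n.+2)%N by case.
elim: n => [|n [IH1 IH2]]; first by rewrite /cheb/= size_poly1 size_polyX.
split => //; rewrite chebSS (leq_trans (size_polyD _ _))// geq_max size_polyN.
apply/andP; split; last by rewrite ltnW// ltnW.
rewrite mulr2n (leq_trans (size_polyD _ _))// maxnn mulrC.
by rewrite (leq_trans (size_polyMleq _ _))// size_polyX addn2.
Qed.

Lemma lead_cheb n : (cheb n.+1)`_n.+1 = 2 ^+ n.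
Proof.
elim: n => [|n IH]; first by rewrite /cheb/= coefX.
rewrite chebSS coefB coefMn coefXM/= IH [X in _ - X]nth_default ?subr0.
  by rewrite exprS mulr_natl.
exact: leq_trans (size_cheb n) _.
Qed.

(** The intervals between consecutive nodes are disjoint, so the roots picked in them are [K]
    distinct ones. *)
Lemma size_gt_of_interlaced_roots (p : {poly R}) (y : nat -> R) K : p != 0 ->
  (forall j, (j < K)%N -> exists2 x, y j.+1 < x < y j & root p x) ->
  (K < size p)%N.
Proof.
move=> p0 H.
have [r rP] : {r : nat -> R & forall j, (j < K)%N ->
    y j.+1 < r j < y j /\ root p (r j)}.
  apply: (@choice _ _ (fun j x => (j < K)%N -> y j.+1 < x < y j /\ root p x)) => j.
  have [jK|] := boolP (j < K)%N; last by exists 0.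
  by have [x] := H j jK; exists x.
rewrite -[X in (X < _)%N](size_mkseq r); apply: max_poly_roots => //.
  by apply/allP => x /mapP[j]; rewrite mem_iota/= add0n => jK ->; case: (rP _ jK).
apply: (@sorted_uniq _ (fun a b : R => b < a)).
- by move=> a b c ab bc; exact: lt_trans bc ab.
- by move=> a; rewrite ltxx.
apply/(sortedP 0) => i; rewrite size_mkseq => iK.
rewrite !nth_mkseq ?(ltnW iK)//.
have [/andP[_ h1] _] := rP _ iK; have [/andP[h2 _] _] := rP _ (ltnW iK).
exact: lt_trans h2.
Qed.

Lemma cosMpi n : cos (pi *+ n) = (-1) ^+ n :> R.
Proof.
rewrite -[pi *+ n]add0r alternatingn ?cos0 ?mulr1//; exact: cosDpi.
Qed.

Lemma cos_pi_frac_gt0 K : (1 < K)%N -> 0 < cos (pi / K.*2%:R) :> R.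
Proof.
move=> K1; have K0 : 0 < K.*2%:R :> R by rewrite ltr0n; lia.
apply: cos_gt0_pihalf; apply/andP; split.
  by rewrite (@lt_trans _ _ 0) ?oppr_lt0 ?divr_gt0 ?pi_gt0.
by rewrite ltr_pM2l ?pi_gt0// ltf_pV2 ?posrE// ltr_nat; lia.
Qed.

(** * The lower bound by alternation *)

Section LowerBound.
Variables (P : {poly R[i]}) (N : nat) (B : R).
Hypotheses (N_gt0 : (0 < N)%N) (sP : (size P <= N.+1)%N) (lP : P`_N = 1).
Hypotheses (P1 : P.[1] = 0) (PB : forall z, normc z = 1 -> normc P.[z] <= B).

(** The distance between [2 k] and [N - 1]: one of the truncated differences is always zero. *)
Let d k := ((k.*2 - N.-1) + (N.-1 - k.*2))%N.

(** Averaging [g t] and [g (- t)] keeps only the real parts of the coefficients of [P] and cosines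
    of multiples of [t], hence a polynomial in [cos t]. *)
Definition cos_poly : {poly R} := \sum_(k < N.+1) complex.Re P`_k *: cheb (d k).

Let g (t : R) := complex.Re (cis (- (t *+ N.-1)) * P.[cis (t *+ 2)]).

Let gE t : g t = \sum_(k < N.+1)
  complex.Re (P`_k * cis (t * (k.*2%:R - N.-1%:R))).
Proof.
rewrite /g (horner_coef_wide _ sP) mulr_sumr Re_sum; apply: eq_bigr => k _.
congr complex.Re; rewrite mulrCA -cisMn -cisD; congr (_ * cis _).
by rewrite -mulrnA -muln2 natrM [_ * 2%:R]mulrC -natrM mulrBr !mulr_natr addrC.
Qed.

Let cosd (t : R) k : cos (t *+ d k) = cos (t * (k.*2%:R - N.-1%:R)).
Proof.
rewrite /d; have [h|h] := leqP k.*2 N.-1.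
  by rewrite (eqP h) add0n -[t *+ _]mulr_natr natrB// -cosN -mulrN opprB.
by rewrite -[t *+ _]mulr_natr (eqP (ltnW h)) addn0 natrB// ltnW.
Qed.

Lemma horner_cos_poly t : cos_poly.[cos t] = (g t + g (- t)) / 2.
Proof.
rewrite !gE -big_split mulr_suml/= horner_sum; apply: eq_bigr => k _.
rewrite hornerZ horner_cheb cosd mulNr cisN.
case: P`_k => a b; by rewrite /cis; simpc => /=; field.
Qed.

Let g_le t : `|g t| <= B.
Proof.
by rewrite (le_trans (le_Re_normc _))// normcM normc_cis mul1r PB// normc_cis.
Qed.

Lemma cos_poly_le y : -1 <= y <= 1 -> `|cos_poly.[y]| <= B.
Proof.
move=> y1; rewrite -[y]acosK ?in_itv//= horner_cos_poly.
have := g_le (acos y); have := g_le (- acos y); rewrite !ler_norml; lra.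
Qed.

Lemma cos_poly1 : cos_poly.[1] = 0.
Proof. by rewrite -cos0 horner_cos_poly oppr0 /g !mul0rn /cis cos0 sin0 P1 mulr0/=; ring. Qed.

(** The point [-1] is [t = pi], where [cis (2 t)] is again [1]: the zero of [P] at [1] is met at
    both end points. *)
Lemma cos_polyN1 : cos_poly.[-1] = 0.
Proof.
have cis2 : cis (pi *+ 2) = 1 :> R[i] by rewrite /cis cos2pi sin2pi.
rewrite -cospi horner_cos_poly /g !mulNrn [cis (- (pi *+ 2))]cisN cis2.
rewrite conjc1 P1 !mulr0/=; ring.
Qed.

Lemma size_cos_poly : (size cos_poly <= N.+2)%N.
Proof.
rewrite (leq_trans (size_sum _ _ _))//; apply/bigmax_leqP => k _.
rewrite (leq_trans (size_scale_leq _ _))// (leq_trans (size_cheb _))//.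
by have := ltn_ord k; rewrite /d; lia.
Qed.

(** Only [k = N] reaches this degree: [d N = 2 N - (N - 1)], and the other values of [d] are at most
    [N - 1]. *)
Lemma lead_cos_poly : cos_poly`_N.+1 = 2 ^+ N.
Proof.
rewrite coef_sum big_ord_recr/= big1 ?add0r => [|k _].
  by rewrite coefZ lP (_ : d N = N.+1) ?lead_cheb ?mul1r// /d; lia.
rewrite coefZ [(cheb _)`_ _]nth_default ?mulr0// (leq_trans (size_cheb _))//.
by have := ltn_ord k; rewrite /d; lia.
Qed.

Let K := N.+1.
Let b : R := pi / K.*2%:R.
(** The largest zero of [T_K], so that [T_K (c y)] vanishes at [y = 1] and [y = -1]. *)
Let c := cos b.

Let bK : b *+ 2 *+ K = pi.
Proof. by rewrite -mulrnA mul2n -[LHS]mulr_natr /b divfK// pnatr_eq0. Qed.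

Let bK2 : b *+ K = pi / 2.
Proof. by rewrite -bK mulrnAC -[_ *+ K *+ 2]mulr_natr mulfK. Qed.

Let b_gt0 : 0 < b.
Proof. by rewrite divr_gt0 ?pi_gt0 ?ltr0n. Qed.

Let bj_le j : (j <= K)%N -> b *+ 2 *+ j <= pi.
Proof. by move=> jK; rewrite -bK ler_wpMn2l// mulrn_wge0// ltW. Qed.

Let bj_in j : (j <= K)%N -> b *+ 2 *+ j \in `[0, pi].
Proof. by move=> jK; rewrite in_itv/= bj_le// andbT !mulrn_wge0// ltW. Qed.

Let b_in : b \in `[0, pi].
Proof. by rewrite in_itv/= ltW//= (le_trans _ (bj_le (ltn0Sn N)))// lerDl ltW. Qed.

Let c_gt0 : 0 < c.
Proof. exact: cos_pi_frac_gt0. Qed.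

(** The extremal points of [T_K (c y)]; the outer two, [y 0] and [y K], fall outside [[-1, 1]], the
    range of the bound on [cos_poly]. *)
Let y j : R := cos (b *+ 2 *+ j) / c.

Let y_dec j : (j < K)%N -> y j.+1 < y j.
Proof.
move=> jK; rewrite ltr_pM2r ?invr_gt0// ltr_cos ?bj_in ?(ltnW jK)//.
by rewrite [ltRHS]mulrSr ltrDl pmulrn_lgt0.
Qed.

Let y0_gt1 : 1 < y 0.
Proof.
by rewrite /y mulr0n cos0 ltr_pdivlMr// mul1r -cos0 ltr_cos// in_itv/= lexx pi_ge0.
Qed.

Let y1_lt1 : y 1 < 1.
Proof.
rewrite /y mulr1n ltr_pdivrMr// mul1r ltr_cos ?(bj_in (ltn0Sn N))//.
by rewrite mulr2n ltrDl.
Qed.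

Let yrev j : (j <= K)%N -> y (K - j) = - y j.
Proof.
move=> jK; rewrite /y mulrnBr// bK cosB cospi sinpi mul0r addr0 mulN1r.
by rewrite mulNr.
Qed.

Let y_le1 j : (0 < j)%N -> (j <= K)%N -> y j < 1.
Proof.
move=> + jK; elim: j jK => // -[|j] IH jK _; first exact: y1_lt1.
by rewrite (lt_trans (y_dec jK))// IH// ltnW.
Qed.

Let y_bnd j : (0 < j < K)%N -> -1 <= y j <= 1.
Proof.
move=> /andP[j0 jK]; rewrite (ltW (y_le1 j0 (ltnW jK))) andbT.
by rewrite lerNl -(yrev (ltnW jK)) ltW// y_le1// ?subn_gt0// leq_subr.
Qed.

Let h : {poly R} := \poly_(i < K.+1) ((cheb K)`_i * c ^+ i).

Let hE x : h.[x] = (cheb K).[c * x].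
Proof.
rewrite horner_poly (horner_coef_wide _ (size_cheb K)); apply: eq_bigr => i _.
by rewrite exprMn mulrA.
Qed.

Let hy j : h.[y j] = (-1) ^+ j.
Proof.
rewrite hE /y mulrC divfK ?gt_eqF// horner_cheb -mulrnA mulnC mulrnA bK.
exact: cosMpi.
Qed.

Let h1 : h.[1] = 0.
Proof.
rewrite hE mulr1 horner_cheb.
by rewrite bK2 cos_pihalf.
Qed.

Let hN1 : h.[-1] = 0.
Proof.
rewrite hE mulrN1 -[- c](_ : cos (pi - b) = _).
  rewrite horner_cheb mulrnBl bK2.
  rewrite cosB cos_pihalf mulr0 add0r (_ : sin (pi *+ K) = 0) ?mul0r//.
  by rewrite -[pi *+ K]add0r alternatingn ?sin0 ?mulr0//; exact: sinDpi.
by rewrite cosB cospi sinpi mul0r addr0 mulN1r.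
Qed.

(* At the extremal points of [T_K (c y) / c ^ K] a competitor of smaller norm
   leaves alternating differences; with the two common zeros at the end points
   this makes one root too many. *)
Lemma chebyshev_lower_bound : 1 <= B * cos (pi / N.+1.*2%:R) ^+ N.+1.
Proof.
rewrite -/K -/b -/c leNgt; apply/negP => Bc.
have cK : 0 < c ^+ K by rewrite exprn_gt0.
(* Both terms have leading coefficient [c ^+ K * 2 ^+ N], so the degree of [e] drops below [K]. *)
pose e := h - c ^+ K *: cos_poly.
have se : (size e <= K)%N.
  have se1 : (size e <= K.+1)%N.
    rewrite (leq_trans (size_polyD _ _))// geq_max size_poly size_polyN.
    by rewrite (leq_trans (size_scale_leq _ _))// size_cos_poly.
  apply/leq_sizeP => i; rewrite leq_eqVlt => /predU1P[<-|Ki]; last first.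
    by rewrite nth_default// (leq_trans se1).
  by rewrite coefB coefZ coef_poly ltnSn lead_cheb lead_cos_poly mulrC subrr.
(* The subtracted term is below [1] in modulus at the inner nodes, so [e] inherits the signs of [h]
   there. *)
have es j : (0 < j < K)%N -> 0 < (-1) ^+ j * e.[y j].
  move=> /[dup] /y_bnd /cos_poly_le + jK.
  rewrite !hornerE hy mulrBr -signr_odd -expr2 sqrr_sign => fB.
  have : `|(-1) ^+ odd j * (c ^+ K * cos_poly.[y j])| < 1.
    rewrite !normrM normr_sign mul1r gtr0_norm// (le_lt_trans _ Bc)// mulrC.
    by rewrite ler_pM2r.
  by rewrite ltr_norml subr_gt0 => /andP[].
have e0 : e != 0.
  apply: contraTneq (es 1%N _) => [->|]; last by rewrite /K; lia.
  by rewrite horner0 mulr0 ltxx.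
suff: (K < size e)%N by rewrite ltnNge se.
(* The first interval contains the root [1], the last one the root [-1], and each inner one a sign
   change. *)
apply: (@size_gt_of_interlaced_roots e y K e0) => j jK; have [->|j0] := posnP j.
  exists 1; first by rewrite y0_gt1 y1_lt1.
  by rewrite rootE !hornerE h1 cos_poly1 mulr0 subrr.
have [jK'|jK'] := eqVneq j.+1 K.
  exists (-1); last by rewrite rootE !hornerE hN1 cos_polyN1 mulr0 subrr.
  have := yrev (leqnn K); rewrite subnn => y0E; have yK : y K = - y 0 by rewrite y0E opprK.
  have jE : j = (K - 1)%N by rewrite -jK' subn1.
  by rewrite jK' yK (_ : y j = - y 1) ?ltrN2 ?y0_gt1 ?y1_lt1// jE yrev.
have j1 : (0 < j.+1 < K)%N by rewrite /= ltn_neqAle jK'.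
have := es _ j1; have := @es j; rewrite j0 jK => /(_ isT) ej ej1.
have [|x xy rx] := @polyrcf.poly_ivtoo _ e _ _ (ltW (y_dec jK)); last by exists x.
have := mulr_gt0 ej ej1; rewrite exprS mulN1r mulNr mulrN mulrACA -expr2.
by rewrite sqrr_sign mul1r oppr_gt0 mulrC.
Qed.

End LowerBound.
End Chebyshev.

(** * A polynomial attaining the lower bound *)

Section ExtremalPolynomial.
Context {R : realType}.
Local Open Scope complex_scope.

Fixpoint extremal_pair (c : R) n : {poly R[i]} * {poly R[i]} :=
  if n is n'.+1 then
    ((extremal_pair c n').2,
     c%:C *: (('X + 1%:P) * (extremal_pair c n').2) - 'X * (extremal_pair c n').1)
  else (c%:C%:P, (c ^+ 2)%:C *: 'X + (c ^+ 2 - 1)%:C%:P).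

(* In terms of [x = c cos t] and the Chebyshev polynomials T, U of both kinds,
   [extremal c n] at [cis t ^ 2] is
   [cis t ^ (n - 1) * (T (n + 1) x + i c sin t * U n x)]. *)
Definition extremal c n := (extremal_pair c n).1.

Lemma extremalSS c n : extremal c n.+2 =
  c%:C *: (('X + 1%:P) * extremal c n.+1) - 'X * extremal c n.
Proof. by []. Qed.

Lemma extremal0 c : extremal c 0 = c%:C%:P. Proof. by []. Qed.

Lemma extremal1 c :
  extremal c 1 = (c ^+ 2)%:C *: 'X + (c ^+ 2 - 1)%:C%:P.
Proof. by []. Qed.

Lemma size_extremal c n : (size (extremal c n) <= n.+1)%N.
Proof.
suff: (size (extremal c n) <= n.+1)%N /\ (size (extremal c n.+1) <= n.+2)%N.
  by case.
elim: n => [|n [IH1 IH2]].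
  rewrite extremal0 extremal1 size_polyC_leq1; split=> //.
  rewrite (leq_trans (size_polyD _ _))// geq_max.
  rewrite (leq_trans (size_scale_leq _ _)) ?size_polyX//=.
  by rewrite (leq_trans (size_polyC_leq1 _)).
split => //; rewrite extremalSS (leq_trans (size_polyD _ _))// geq_max size_polyN.
rewrite (leq_trans (size_scale_leq _ _))//=.
  by rewrite (leq_trans (size_polyMleq _ _))// size_polyX/= ltnS ltnW.
by rewrite (leq_trans (size_polyMleq _ _))// size_XaddC.
Qed.

Lemma lead_extremal c n : (extremal c n)`_n = (c ^+ n.+1)%:C.
Proof.
elim: n => [|n IH]; first by rewrite extremal0 coefC expr1.
case: n IH => [|n] IH.
  by rewrite extremal1 coefD coefZ coefX coefC mulr1 addr0.
rewrite extremalSS coefB coefZ polyC1 mulrDl mul1r coefD !coefXM/= IH.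
rewrite !(nth_default _ (size_extremal _ _)) addr0 subr0.
by rewrite -rmorphM/= -exprS.
Qed.

(** At [z = 1] and [c = cos b] the recurrence is the one satisfied by [cos (b *+ m)]. *)
Lemma extremal_at1 (b : R) n : (extremal (cos b) n).[1] = (cos (b *+ n.+1))%:C.
Proof.
suff: (extremal (cos b) n).[1] = (cos (b *+ n.+1))%:C /\
      (extremal (cos b) n.+1).[1] = (cos (b *+ n.+2))%:C by case.
elim: n => [|n [IH1 IH2]].
  rewrite extremal0 extremal1 !hornerE mulr1n; split => //.
  by rewrite -rmorphD/= cos_mulr2n mulr2n; congr _%:C; ring.
split => //; rewrite extremalSS (cosMSS b n.+1) !hornerE IH1 IH2.
by simpc; congr Complex; ring.
Qed.

(** The pair [(T_n x, U_(n-1) x)]: each step multiplies [T + U sqrt (x ^ 2 - 1)] by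
    [x + sqrt (x ^ 2 - 1)], an element of norm [1], whence Pell's identity. *)
Let TU (x : R) n : R * R := iter n
  (fun v => (x * v.1 - (1 - x ^+ 2) * v.2, v.1 + x * v.2)) (1, 0).

Let TUS x n : TU x n.+1 =
  (x * (TU x n).1 - (1 - x ^+ 2) * (TU x n).2, (TU x n).1 + x * (TU x n).2).
Proof. by []. Qed.

Let TU_pell x n : (TU x n).1 ^+ 2 + (1 - x ^+ 2) * (TU x n).2 ^+ 2 = 1.
Proof.
elim: n => [|n IH]; first by rewrite /= expr0n/= mulr0 addr0 expr1n.
by rewrite TUS/= -[RHS]IH; ring.
Qed.

(** The factor [cis t] on the left avoids the exponent [n - 1], negative at [n = 0]. As
    [cis t ^+ 2 + 1] is [2 cos t cis t], the recurrence becomes the three-term recurrence of [T] and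
    [U] at [x = c cos t]. *)
Let horner_extremal c (t : R) n :
  (extremal c n).[cis t ^+ 2] * cis t = cis t ^+ n *
    ((TU (c * cos t) n.+1).1 +i* (c * sin t * (TU (c * cos t) n.+1).2)).
Proof.
set x := c * cos t.
suff H m : (extremal c m).[cis t ^+ 2] * cis t = cis t ^+ m *
    ((TU x m.+1).1 +i* (c * sin t * (TU x m.+1).2)) /\
    (extremal c m.+1).[cis t ^+ 2] * cis t = cis t ^+ m.+1 *
    ((TU x m.+2).1 +i* (c * sin t * (TU x m.+2).2)) by have [] := H n.
have s2 := sin2cos2 t.
elim: m => [|m [IH1 IH2]].
  rewrite extremal0 extremal1 expr0 expr1 !hornerE /cis/= /x; split.
    by simpc; congr Complex; ring.
  rewrite expr2; simpc; congr Complex.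
    transitivity (c ^+ 2 * cos t * (cos t ^+ 2 - 3 * sin t ^+ 2) +
      (c ^+ 2 - 1) * cos t); first by ring.
    transitivity (cos t * (x ^+ 2 * 2 - 1) - 2 * c * sin t ^+ 2 * x ); last by rewrite /x; ring.
    by rewrite /x s2; ring.
  transitivity (c ^+ 2 * sin t * (3 * cos t ^+ 2 - sin t ^+ 2) +
    (c ^+ 2 - 1) * sin t); first by ring.
  transitivity (sin t * (x ^+ 2 * 2 - 1) + 2 * c * sin t * cos t * x ); last by rewrite /x; ring.
  by rewrite /x s2; ring.
split => //; rewrite extremalSS hornerD hornerN hornerZ !hornerM hornerD hornerX hornerC.
have cis1 : cis t ^+ 2 + 1 = cis t * (2 * cos t)%:C.
  rewrite /cis expr2; simpc; congr Complex; last by ring.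
  transitivity (cos t ^+ 2 - sin t ^+ 2 + 1); first by ring.
  by rewrite s2; ring.
transitivity (c%:C * (cis t ^+ 2 + 1) * ((extremal c m.+1).[cis t ^+ 2] * cis t)
  - cis t ^+ 2 * ((extremal c m).[cis t ^+ 2] * cis t)); first by ring.
rewrite IH1 IH2 cis1.
transitivity (cis t ^+ m.+2 *
  ((2 * x)%:C * ((TU x m.+2).1 +i* (c * sin t * (TU x m.+2).2)) -
   ((TU x m.+1).1 +i* (c * sin t * (TU x m.+1).2)))).
  rewrite (_ : (2 * x)%:C = c%:C * (2 * cos t)%:C).
    rewrite !exprS; move: (cis t ^+ m) (cis t) (_ +i* _) (_ +i* _) => w v E F.
    by move: c%:C (2 * cos t)%:C => a d; ring.
  by rewrite -rmorphM/=; congr _%:C; rewrite /x; ring.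
congr (_ * _); rewrite !TUS/=; simpc; congr Complex; ring.
Qed.

(** With [x = c cos t] the squared modulus is [T ^ 2 + c ^ 2 sin t ^ 2 U ^ 2], and
    [c ^ 2 sin t ^ 2 <= 1 - x ^ 2]; Pell's identity concludes. *)
Lemma normc_extremal_le1 c n z : c ^+ 2 <= 1 -> normc z = 1 ->
  normc (extremal c n).[z] <= 1.
Proof.
move=> c1 /cis_surj[t _ <-].
have -> : cis t = cis (t / 2) ^+ 2 by rewrite -cisMn -[t / 2 *+ 2]mulr_natr divfK// pnatr_eq0.
set s := t / 2.
have := horner_extremal c s n => /(congr1 (@normc R)).
rewrite !normcM normcX normc_cis expr1n mulr1 mul1r => ->.
rewrite -(@ler_pXn2r _ 2) ?nnegrE ?normc_ge0// expr1n sqr_normcE/=.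
rewrite -{2}(TU_pell (c * cos s) n.+1) lerD2l exprMn ler_wpM2r ?sqr_ge0//.
rewrite !exprMn lerBrDr -mulrDr addrC cos2Dsin2 mulr1//.
Qed.

(** For [c = cos (pi / 2K)] the polynomial [extremal c n.+1] vanishes at [1]; [q] is its quotient by
    ['X - 1], divided by the leading coefficient [c ^+ K]. *)
Lemma extremal_competitor n : exists q : {poly R[i]},
  [/\ q \is monic, size q = n.+1 & forall z, normc z = 1 ->
    normc ((z - 1) * q.[z]) * cos (pi / n.+2.*2%:R) ^+ n.+2 <= 1].
Proof.
set K := n.+2; set b := pi / K.*2%:R; set c := cos b.
have c0 : 0 < c by exact: cos_pi_frac_gt0.
have cK : 0 < c ^+ K by rewrite exprn_gt0.
have cC : (c ^+ K)%:C != 0 by rewrite fmorph_eq0 gt_eqF.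
have r1 : root (extremal c n.+1) 1.
  rewrite rootE extremal_at1 (_ : b *+ n.+2 = pi / 2) ?cos_pihalf//.
  rewrite -[b *+ _]mulr_natr /b /K -muln2 natrM.
  have : n.+2%:R != 0 :> R by rewrite pnatr_eq0.
  move: n.+2%:R => m m0; by field.
have [q Dq] := factor_theorem _ _ r1.
have lE := lead_extremal c n.+1.
have sE : size (extremal c n.+1) = n.+2.
  apply/eqP; rewrite eqn_leq size_extremal ltnNge; apply: contraNN cC => h.
  by rewrite -lE nth_default.
have sq : size q = n.+1.
  have q0 : q != 0.
    by apply/eqP => q0; move: sE; rewrite Dq q0 mul0r size_poly0.
  by move: sE; rewrite Dq size_Mmonic ?monicXsubC// size_XsubC addn2/= => -[].
have lq : lead_coef q = (c ^+ K)%:C.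
  transitivity (lead_coef (extremal c n.+1)); last by rewrite lead_coefE sE lE.
  by rewrite Dq lead_coef_Mmonic// monicXsubC.
exists ((c ^+ K)%:C^-1 *: q); split.
- by rewrite monicE lead_coefZ lq mulVf.
- by rewrite size_scale// invr_eq0.
move=> z z1; rewrite hornerZ [(z - 1) * _]mulrCA [normc (_^-1 * _)]normcM normcV normc_real.
rewrite gtr0_norm// mulrC mulrA mulfV ?gt_eqF// mul1r.
have -> : (z - 1) * q.[z] = (extremal c n.+1).[z].
  by rewrite Dq hornerM hornerXsubC mulrC.
by apply: normc_extremal_le1 => //; rewrite cos2sin2 gerBl sqr_ge0.
Qed.

End ExtremalPolynomial.

(** * Comparison of the minimal norms in consecutive degrees *)

Section Gap.
Context {R : realType}.

Lemma bernoulli_ge (w : R) n : 0 <= w -> 1 + w *+ n <= (1 + w) ^+ n.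
Proof.
move=> w0; elim: n => [|n IH]; first by rewrite mulr0n addr0.
rewrite exprS mulrS (le_trans _ (ler_wpM2l _ IH)) ?addr_ge0//.
have : 0 <= w * w *+ n by rewrite mulrn_wge0// mulr_ge0.
rewrite -mulrnAr; move: (w *+ n) => m; lra.
Qed.

Lemma sinMn_le (t : R) n : `|sin (t *+ n)| <= `|sin t| *+ n.
Proof.
elim: n => [|n IH]; first by rewrite mulr0n sin0 normr0.
rewrite mulrS sinD mulrS (le_trans (ler_normD _ _))// lerD// normrM.
  by rewrite ler_piMr// cos_max.
by rewrite (le_trans _ IH)// ler_piMl// cos_max.
Qed.

(** Passing from [L] to [L + 1] adds [2 (L + 1) (1 - cos u) cos ((L + 1) u) >= 0] to the right-hand
    side, whose value at [L = 1] is the left-hand side. *)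
Lemma cos_telescope_ge (u : R) L : (0 < L)%N -> 0 <= u -> u *+ L <= pi / 2 ->
  1 + 2 * (cos u * (1 - cos u)) <= L.+1%:R * cos (u *+ L) - L%:R * cos (u *+ L.+1).
Proof.
move=> L0 u0; case: L L0 => // L _.
elim: L => [|L IH] h.
  rewrite mulr1n cos_mulr2n mulr2n; lra.
have h' : u *+ L.+1 <= pi / 2 by rewrite (le_trans _ h)// ler_wpMn2l.
rewrite (le_trans (IH h'))// (cosMSS u L.+1).
have : 0 <= cos (u *+ L.+2).
  apply: cos_ge0_pihalf; rewrite h andbT (@le_trans _ _ 0)// ?mulrn_wge0//.
  by rewrite oppr_le0 divr_ge0// pi_ge0.
have := cos_le1 u.
rewrite -[L.+3%:R]natr1 -[L.+2%:R]natr1.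
move: (cos (u *+ L.+2)) (cos (u *+ L.+1)) (cos u) => x y c c1 x0.
have n0 : 0 <= L.+1%:R :> R by [].
move: L.+1%:R n0 => n n0.
have : 0 <= (n + 1) * x * (1 - c) by rewrite mulr_ge0 ?subr_ge0// mulr_ge0// addr_ge0.
rewrite mulr2n; lra.
Qed.

(** The minimal norms are the inverses of these powers, so this measures their drop. Bernoulli's
    inequality reduces it to a linear inequality between the two cosines. *)
Lemma cos_pow_gap L : (1 < L)%N ->
  cos (pi / L.*2%:R) ^+ L * (1 + (2 * L.+1%:R ^+ 4)^-1)
  <= cos (pi / L.+1.*2%:R) ^+ L.+1 :> R.
Proof.
(* A common unit for the two angles: [pi / 2L] is [(L + 1) u] and [pi / 2(L + 1)] is [L u]. *)
move=> L1; pose u : R := pi / (L * L.+1).*2%:R.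
have L0 : L%:R != 0 :> R by rewrite pnatr_eq0; lia.
have L10 : L.+1%:R != 0 :> R by rewrite pnatr_eq0.
have uL : u *+ L = pi / L.+1.*2%:R.
  rewrite -[u *+ _]mulr_natr /u -!muln2 !natrM.
  by move: L%:R L.+1%:R L0 L10 => ? ? ? ?; field; apply/andP.
have uL1 : u *+ L.+1 = pi / L.*2%:R.
  rewrite -[u *+ _]mulr_natr /u -!muln2 !natrM.
  by move: L%:R L.+1%:R L0 L10 => ? ? ? ?; field; apply/andP.
have uLL : u *+ (L * L.+1) = pi / 2.
  rewrite -[u *+ _]mulr_natr /u -!muln2 !natrM.
  by move: L%:R L.+1%:R L0 L10 => ? ? ? ?; field; apply/andP.
have u0 : 0 <= u by rewrite divr_ge0 ?pi_ge0.
rewrite -uL -uL1.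
have uM m : (m <= L * L.+1)%N -> u *+ m <= pi / 2 by move=> ?; rewrite -uLL ler_wpMn2l.
have cM m : (m <= L * L.+1)%N -> 0 <= cos (u *+ m).
  move=> mL; apply: cos_ge0_pihalf; rewrite uM// andbT (@le_trans _ _ 0) ?mulrn_wge0//.
  by rewrite oppr_le0 divr_ge0// pi_ge0.
have x0 : 0 < cos (u *+ L.+1) by rewrite uL1 cos_pi_frac_gt0.
have x1 := cos_le1 (u *+ L.+1).
have := @cos_telescope_ge u L (ltnW L1) u0 (uM L _).
move=> /(_ ltac:(nia)).
set x := cos (u *+ L.+1) in x0 x1 *; set y := cos (u *+ L) => H.
have c0 := cM 1%N ltac:(nia); have c2 := cM 2%N ltac:(nia).
rewrite mulr1n in c0; rewrite cos_mulr2n mulr2n in c2.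
(* From [1 = sin (pi / 2) <= L (L + 1) |sin u|]. *)
have s1 : 1 <= sin u ^+ 2 * (L * L.+1)%:R ^+ 2.
  have := sinMn_le u (L * L.+1); rewrite uLL sin_pihalf normr1 -[`|_| *+ _]mulr_natr => h.
  by rewrite -[sin u ^+ 2]real_normK ?num_real// -exprMn exprn_ege1.
rewrite sin2cos2 in s1.
have LL : (L * L.+1)%:R ^+ 2 <= L.+1%:R ^+ 4 :> R.
  by rewrite (exprM _ 2 2) ler_pXn2r ?nnegrE ?sqr_ge0// -natrX ler_nat -mulnn leq_mul2r leqnSn orbT.
have K4 : 0 < L.+1%:R ^+ 4 :> R by rewrite exprn_gt0.
have c1 := cos_le1 u.
have eps : (2 * L.+1%:R ^+ 4)^-1 <= 2 * (cos u * (1 - cos u)).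
  rewrite invfM -[leRHS](mulfK (lt0r_neq0 K4)) ler_pM2r ?invr_gt0//.
  have c20 : 0 <= 1 - cos u ^+ 2 by rewrite -sin2cos2 sqr_ge0.
  have h1 : 1 <= (1 - cos u ^+ 2) * L.+1%:R ^+ 4 by rewrite (le_trans s1)// ler_wpM2l.
  (* [cos (2 u) >= 0] keeps [cos u] above [1 / 3], so that [1 + cos u <= 4 cos u]. *)
  have h2 : 1 - cos u ^+ 2 <= 4 * (cos u * (1 - cos u)) by nra.
  have h3 : (1 - cos u ^+ 2) * L.+1%:R ^+ 4 <= 4 * (cos u * (1 - cos u)) * L.+1%:R ^+ 4.
    by rewrite ler_wpM2r// ltW.
  by rewrite -[2^-1]mulr1; lra.
set e := (_)^-1 in eps *.
have e0 : 0 < e by rewrite invr_gt0 mulr_gt0.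
have {eps}H : 1 + e <= L.+1%:R * y - L%:R * x by apply: le_trans H; rewrite lerD2l.
(* Chosen so that Bernoulli gives [(1 + w) ^+ L.+1 >= (1 + e) / x], while [x (1 + w) <= y] is a
   rewriting of [H]. *)
pose w := ((1 + e) / x - 1) / L.+1%:R.
have w0 : 0 <= w.
  by rewrite divr_ge0// subr_ge0 ler_pdivlMr// mul1r; lra.
have yx : x * (1 + w) <= y.
  have Lp : 0 < L.+1%:R :> R by rewrite ltr0n.
  rewrite -(ler_pM2r Lp) (_ : x * (1 + w) * L.+1%:R = L%:R * x + (1 + e));
    first by rewrite [y * _]mulrC; lra.
  by have := L10; rewrite /w -natr1 => L10'; field; rewrite L10' gt_eqF.
have := @bernoulli_ge w L.+1 w0; rewrite -[w *+ _]mulr_natr /w divfK// => B.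
have -> : x ^+ L * (1 + e) = x ^+ L.+1 * (1 + ((1 + e) / x - 1)).
  by rewrite exprS; field; rewrite gt_eqF.
rewrite (@le_trans _ _ ((x * (1 + w)) ^+ L.+1))//.
  by rewrite exprMn ler_wpM2l// exprn_ge0// ltW.
have xw0 : 0 <= x * (1 + w) by exact: mulr_ge0 (ltW x0) (addr_ge0 ler01 w0).
have y0 : 0 <= y by apply: cM; rewrite leq_pmulr.
by rewrite ler_pXn2r.
Qed.

End Gap.

(** * First estimates for weighted Chebyshev polynomials *)

Section WeightedChebyshev.
Context {R : realType}.
Implicit Types (p q : {poly R[i]}) (z : R[i]) (n : nat).

Lemma normc_w1_le2 z : normc z = 1 -> normc (w1 z) <= 2.
Proof.
by move=> z1; rewrite (le_trans (le_normcD _ _))// normcN normc1 z1.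
Qed.

Lemma le_weighted_norm p z : normc z = 1 ->
  normc (w1 z * p.[z]) <= weighted_norm (@w1 R) p.
Proof.
move=> z1; apply: ub_le_sup; last by exists z.
exists (2 * \sum_(i < size p) normc p`_i) => _ [x x1 <-].
by rewrite normcM ler_pM ?normc_ge0 ?normc_w1_le2 ?horner_normc_le.
Qed.

Lemma weighted_norm_le p B :
  (forall z, normc z = 1 -> normc (w1 z * p.[z]) <= B) ->
  weighted_norm (@w1 R) p <= B.
Proof.
move=> pB; apply: ge_sup => [|_ [z z1 <-]]; last exact: pB.
by exists (normc (w1 1 * p.[1])); exists 1 => //; exact: normc1.
Qed.

Lemma weighted_chebyshev_min w n p q : weighted_chebyshev w n p ->
  q \is monic -> size q = n.+1 -> weighted_norm w p <= weighted_norm w q.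
Proof.
move=> [_ _ pmin] /monicP lq sq; have [r Dq] := closed_field_poly_normal q.
rewrite lq scale1r in Dq.
have sr : size r = n by move: sq; rewrite Dq size_prod_XsubC => -[].
suff -> : q = \prod_(k < n) ('X - (r`_k)%:P) by exact: pmin.
by rewrite [LHS]Dq (big_nth 0) big_mkord sr.
Qed.

Lemma weighted_chebyshev_le2 n p : weighted_chebyshev (@w1 R) n p ->
  weighted_norm (@w1 R) p <= 2.
Proof.
move=> pC; have := weighted_chebyshev_min pC (monicXn _ n) (size_polyXn _ n).
move=> /le_trans; apply; apply: weighted_norm_le => z z1.
by rewrite hornerXn normcM normcX z1 expr1n mulr1 normc_w1_le2.
Qed.

(* Deleting the constant term [p`_0] and dividing by ['X] produces a competitor
   of degree [n - 1], so the drop of the minimal norm from degree [n - 1] to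
   degree [n] bounds [2 |p`_0|] from below. *)
Lemma weighted_chebyshev_coef0 n p : (0 < n)%N -> weighted_chebyshev (@w1 R) n p ->
  (4 * n.+2%:R ^+ 4)^-1 <= normc p`_0.
Proof.
move=> n0 pC; have [/monicP lp sp _] := pC.
set M := weighted_norm (@w1 R) p; set eta := normc p`_0.
pose p1 : {poly R[i]} := \poly_(i < n) p`_i.+1.
have pE : p = p1 * 'X + (p`_0)%:P.
  apply/polyP => -[|i]; rewrite coefD coefMX coefC/= ?add0r//.
  rewrite addr0 coef_poly; case: ltnP => // ni.
  by rewrite nth_default// sp.
have [q [mq sq qle]] := extremal_competitor (R := R) n.
set C1 := cos _ ^+ n.+2 in qle.
have C10 : 0 < C1 by rewrite exprn_gt0// cos_pi_frac_gt0.
have MC1 : M * C1 <= 1.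
  rewrite -ler_pdivlMr// (le_trans (weighted_chebyshev_min pC mq sq))//.
  by apply: weighted_norm_le => z /qle; rewrite ler_pdivlMr.
have C11 : C1 <= 1.
  by rewrite exprn_ile1 ?cos_le1 ?ltW// cos_pi_frac_gt0.
have := @cos_pow_gap R n.+1 n0; set C0 := cos _ ^+ n.+1; rewrite -/C1 => gap.
have C00 : 0 < C0 by rewrite exprn_gt0// cos_pi_frac_gt0.
have M0 : 0 <= M.
  by rewrite (le_trans _ (@le_weighted_norm p 1 _)) ?normc_ge0 ?normc1.
(* On the circle [(z - 1) p1] has the modulus of [(z - 1) (p - p(0))], at most [M + 2 eta], so the
   lower bound for degree [n - 1] applies. *)
have low : 1 <= (M + 2 * eta) * C0.
  apply: (@chebyshev_lower_bound _ (('X - 1%:P) * p1)) => //.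
  - by rewrite mulrC (leq_trans (size_polyMleq _ _))// size_XsubC addn2/= ltnS size_poly.
  - rewrite mulrBl polyC1 mul1r coefB coefXM gtn_eqF// !coef_poly ltnn subr0.
    by rewrite ltn_predL n0 prednK// -lp lead_coefE sp.
  - by rewrite hornerM hornerXsubC subrr mul0r.
  move=> z z1; rewrite hornerM hornerXsubC.
  have -> : normc ((z - 1) * p1.[z]) = normc (w1 z * (p.[z] - p`_0)).
    rewrite {1}pE hornerD hornerMX hornerC addrK !normcM z1 mulr1//.
  rewrite mulrBr (le_trans (le_normcD _ _))// lerD ?le_weighted_norm//.
  by rewrite normcN normcM ler_wpM2r ?normc_ge0 ?normc_w1_le2.
have eta0 : 0 <= eta by exact: normc_ge0.
set e := (2 * n.+2%:R ^+ 4)^-1 in gap.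
have e0 : 0 < e by rewrite invr_gt0 mulr_gt0// exprn_gt0// ltr0n.
suff : e <= 2 * eta.
  rewrite (_ : (_)^-1 = e / 2); first by lra.
  by rewrite /e -invfM; congr _^-1; ring.
(* The chain to reach is [1 + e <= (M + 2 eta) C1 <= 1 + 2 eta]. *)
have h1 : 1 + e <= (M + 2 * eta) * (C0 * (1 + e)).
  by rewrite mulrA ler_peMl// addr_ge0// ltW.
have h2 : (M + 2 * eta) * (C0 * (1 + e)) <= (M + 2 * eta) * C1.
  by rewrite ler_wpM2l// addr_ge0// mulr_ge0.
have h3 : 2 * eta * C1 <= 2 * eta by rewrite ler_piMr// mulr_ge0.
lra.
Qed.

End WeightedChebyshev.

(** * Mahler measure and the number of zeros off the circle *)

Section Zeros.
Context {R : realType}.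
Implicit Types (s : seq R[i]) (a z : R[i]).

(** Some [al a] may vanish, hence a size bound and the coefficient at index [size s] in place of a
    leading coefficient. *)
Lemma coef_prod_linear (T : Type) (s : seq T) (al be : T -> R[i]) :
  (size (\prod_(a <- s) (al a *: 'X + (be a)%:P) : {poly R[i]})%R <= (size s).+1)%N /\
  (\prod_(a <- s) (al a *: 'X + (be a)%:P))`_(size s) = \prod_(a <- s) al a.
Proof.
elim: s => [|a s [IH1 IH2]]; first by rewrite !big_nil size_poly1 coef1.
rewrite !big_cons; set Q := \prod_(j <- s) _ in IH1 IH2 *; split.
  rewrite (leq_trans (size_polyMleq _ _))//.
  have : (size (al a *: 'X + (be a)%:P)%R <= 2)%N.
    rewrite (leq_trans (size_polyD _ _))// geq_max.
    rewrite (leq_trans (size_scale_leq _ _)) ?size_polyX//=.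
    by rewrite (leq_trans (size_polyC_leq1 _)).
  by move=> l2; rewrite -subn1 leq_subLR; exact: leq_trans (leq_add l2 IH1) _.
rewrite mulrDl coefD -scalerAl coefZ coefXM/= IH2 mul_polyC coefZ.
by rewrite nth_default// mulr0 addr0.
Qed.

(* Reflecting the zeros outside the disc keeps the modulus on the circle and
   turns the Mahler measure into the leading coefficient. *)
Lemma mahler_le s B :
  (forall z, normc z = 1 -> normc (\prod_(a <- s) ('X - a%:P)).[z] <= B) ->
  \prod_(a <- s) Num.max 1 (normc a) <= B.
Proof.
move=> sB.
pose al a : R[i] := if normc a <= 1 then 1 else - (a^*)%C.
pose be a : R[i] := if normc a <= 1 then - a else 1.
have [_ lQ] := coef_prod_linear s al be.
rewrite (eq_bigr (fun a => normc (al a))); last first.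
  move=> a _; rewrite /al; case: leP => a1; first by rewrite normc1.
  by rewrite normcN normc_conj.
rewrite -normc_prod -lQ; apply: normc_coef_le => z z1; rewrite (le_trans _ (sB _ z1))//.
rewrite !horner_prod !normc_prod le_eqVlt; apply/orP/or_introl/eqP.
apply: eq_bigr => a _; rewrite hornerD hornerZ hornerX hornerC hornerXsubC /al /be.
case: leP => _; first by rewrite mul1r.
rewrite -[RHS]normc_conj -[RHS]mul1r -z1 -normcM rmorphB/= mulrBr mulcJ_normc z1.
by rewrite expr1n mulNr addrC mulrC.
Qed.

Lemma prod_max1_ge1 s : 1 <= \prod_(a <- s) Num.max 1 (normc a).
Proof.
elim/big_ind : _ => // [x y x1 y1|a _]; last by rewrite le_max lexx.
by rewrite mulr_ege1.
Qed.

(** Each point of the disc contributes at most [r]; a lower bound on the product thus limits their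
    number. *)
Lemma prod_normc_le_count s r : 0 <= r ->
  \prod_(a <- s) normc a <=
  r ^+ count (fun a => normc a <= r) s * \prod_(a <- s) Num.max 1 (normc a).
Proof.
move=> r0; elim: s => [|a s IH]; first by rewrite !big_nil mulr1.
rewrite !big_cons exprD mulrACA ler_pM ?normc_ge0//.
  by rewrite prodr_ge0// => i _; exact: normc_ge0.
case: (leP (normc a) r) => /= [ar|ra]; last by rewrite expr0 mul1r le_max lexx orbT.
by rewrite expr1 (le_trans ar)// ler_peMr// le_max lexx.
Qed.

Lemma count_le_prod_max s r : 0 < r -> r < 1 ->
  r^-1 ^+ count (fun a => r^-1 <= normc a) s <= \prod_(a <- s) Num.max 1 (normc a).
Proof.
move=> r0 r1; have ri0 : 0 <= r^-1 by rewrite invr_ge0 ltW.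
elim: s => [|a s IH]; first by rewrite big_nil.
rewrite big_cons exprD ler_pM ?exprn_ge0//.
case: (leP r^-1 (normc a)) => /= [ar|ra]; last by rewrite expr0 le_max lexx.
by rewrite expr1 le_max ar orbT.
Qed.

Lemma normc_le_prod_max s a : a \in s ->
  normc a <= \prod_(a <- s) Num.max 1 (normc a).
Proof.
move=> aS; rewrite (big_rem a)//= (le_trans _ (ler_peMr _ (prod_max1_ge1 _)))//.
  by rewrite le_max lexx orbT.
by rewrite le_max ler01.
Qed.

Lemma zerosE (p : {poly R[i]}) : p \is monic ->
  p = \prod_(a <- zeros p) ('X - a%:P).
Proof.
move=> /monicP lp; have := svalP (closed_field_poly_normal p).
by rewrite -/(zeros p) [X in X *: _]lp scale1r.
Qed.

Lemma size_zeros (p : {poly R[i]}) n : p \is monic -> size p = n.+1 ->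
  size (zeros p) = n.
Proof. by move=> /zerosE pE; rewrite {1}pE size_prod_XsubC => -[]. Qed.

Section ZerosOfChebyshev.
Variables (n : nat) (p : {poly R[i]}).
Hypotheses (n_gt0 : (0 < n)%N) (pC : weighted_chebyshev (@w1 R) n p).

(** Mahler's bound is applied to [(z - 1) p], whose additional zero [1] contributes the factor
    [1]. *)
Lemma prod_max1_zeros_le2 : \prod_(a <- zeros p) Num.max 1 (normc a) <= 2.
Proof.
have [mp _ _] := pC.
rewrite (_ : \prod_(a <- _) _ = \prod_(a <- 1 :: zeros p) Num.max 1 (normc a)).
  apply: mahler_le => z z1; rewrite big_cons -zerosE// hornerM hornerXsubC.
  by rewrite (le_trans (le_weighted_norm _ z1))// (weighted_chebyshev_le2 pC).
by rewrite big_cons normc1 maxxx mul1r.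
Qed.

Lemma zeros_le2 a : a \in zeros p -> normc a <= 2.
Proof. by move=> /normc_le_prod_max /le_trans; apply; exact: prod_max1_zeros_le2. Qed.

(** The product of the moduli of the zeros is at least [1 / (4 (n + 2) ^ 4)] by the estimate of
    [p(0)], and at most [2 r ^ m] where [m] is the count. *)
Lemma count_zeros_small r : 0 < r -> r < 1 ->
  r^-1 ^+ count (fun a => normc a <= r) (zeros p) <= 8 * n.+2%:R ^+ 4.
Proof.
have aux (x k : R) : 1 <= x * 2 * (4 * k) -> 1 <= 8 * k * x by lra.
move=> r0 r1; have [mp _ _] := pC.
have p0 : normc p`_0 = \prod_(a <- zeros p) normc a.
  rewrite -horner_coef0 {1}(zerosE mp) horner_prod normc_prod.
  by apply: eq_bigr => a _; rewrite hornerXsubC add0r normcN.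
have := weighted_chebyshev_coef0 n_gt0 pC; rewrite p0 => h.
have {h} := le_trans h (prod_normc_le_count (zeros p) (ltW r0)).
set m := count _ _; have rm : 0 < r ^+ m by rewrite exprn_gt0.
have K4 : 0 < n.+2%:R ^+ 4 :> R by rewrite exprn_gt0// ltr0n.
move=> h; have {h} := le_trans h (ler_wpM2l (ltW rm) prod_max1_zeros_le2).
rewrite -[leLHS]mul1r ler_pdivrMr ?mulr_gt0// => h.
by rewrite exprVn -[leLHS]mul1r ler_pdivrMr//; exact: aux.
Qed.

(** The Mahler bound [2] is weakened to the same right-hand side as for the small zeros. *)
Lemma count_zeros_large r : 0 < r -> r < 1 ->
  r^-1 ^+ count (fun a => r^-1 <= normc a) (zeros p) <= 8 * n.+2%:R ^+ 4.
Proof.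
move=> r0 r1; rewrite (le_trans (count_le_prod_max _ r0 r1))//.
rewrite (le_trans prod_max1_zeros_le2)//.
have aux (k : R) : 1 <= k -> 2 <= 8 * k by lra.
by apply: aux; rewrite exprn_ege1// ler1n.
Qed.

End ZerosOfChebyshev.
End Zeros.

(** * Logarithmic counts are negligible against [n] *)

Section Growth.
Context {R : realType}.

(** Logarithms would give [m n = O(log n)]; the cruder [O(sqrt n)] suffices and comes from
    [ln x < x] at [x = sqrt (n + 2)]. *)
Lemma cvg_log_count (rho : R) (m : nat -> nat) : 1 < rho ->
  (forall n, (0 < n)%N -> rho ^+ m n <= 8 * n.+2%:R ^+ 4) ->
  (m n)%:R / n%:R @[n --> \oo] --> (0 : R).
Proof.
move=> rho1 mle; have l0 : 0 < ln rho by exact: ln_gt0.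
(* From [ln 8 + 4 ln (n + 2) <= ln 8 + 16 sqrt n], where [n + 2 <= 4 n]. *)
pose A : R := ln 8 + 16; have A0 : 0 < A by rewrite addr_gt0// ln_gt0// ltr1n.
have bnd n : (0 < n)%N -> (m n)%:R * ln rho <= A * Num.sqrt n%:R.
  move=> n0; set K : R := n.+2%:R; have K0 : 0 < K by rewrite ltr0n.
  have sn1 : 1 <= Num.sqrt n%:R :> R by have := @ler_wsqrtr R 1 n%:R; rewrite sqrtr1 ler1n; apply.
  have rho0 : 0 < rho by exact: lt_trans rho1.
  have r0 : 0 < rho ^+ m n by rewrite exprn_gt0.
  have K40 : 0 < K ^+ 4 by rewrite exprn_gt0.
  have K80 : 0 < 8 * K ^+ 4 by rewrite mulr_gt0.
  have := mle n n0; rewrite -ler_ln ?posrE//.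
  rewrite lnXn// lnM ?posrE// lnXn// -[ln rho *+ _]mulr_natl -[ln K *+ 4]mulr_natl.
  have sK : Num.sqrt K <= 2 * Num.sqrt n%:R.
    have -> : 2 = Num.sqrt (4 : R).
      by rewrite (_ : 4 = 2 ^+ 2) ?sqrtr_sqr ?ger0_norm// expr2 -natrM.
    by rewrite -sqrtrM// ler_wsqrtr// -natrM ler_nat; lia.
  have lK : ln K <= 2 * Num.sqrt K.
    have sK0 : 0 < Num.sqrt K by rewrite sqrtr_gt0.
    rewrite -{1}(sqr_sqrtr (ltW K0)) lnXn// -[ln _ *+ 2]mulr_natl ler_pM2l//.
    by rewrite ltW// ln_sublinear.
  have l8 : 0 <= ln (8 : R) by rewrite ln_ge0// ler1n.
  move=> /le_trans; apply; rewrite /A.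
  have : 0 <= ln (8 : R) * (Num.sqrt n%:R - 1) by rewrite mulr_ge0// subr_ge0.
  move: (Num.sqrt n%:R) (Num.sqrt K) (ln K) (ln 8) sK lK => a b c d; lra.
apply/cvgrPdist_le => e e0.
pose S := A / (ln rho * e); have S0 : 0 < S by rewrite divr_gt0// mulr_gt0.
near=> n.
have n0 : (0 < n)%N by near: n; exists 1%N.
have nS : S ^+ 2 <= n%:R by near: n; exact: nbhs_infty_ger.
have nS' : S <= Num.sqrt n%:R.
  by rewrite -(ger0_norm (ltW S0)) -sqrtr_sqr ler_wsqrtr.
have n0' : 0 < n%:R :> R by rewrite ltr0n.
rewrite sub0r normrN ger0_norm ?divr_ge0// ler_pdivrMr// -(ler_pM2r l0).
rewrite (le_trans (bnd _ n0))//.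
rewrite -[in leRHS](sqr_sqrtr (ltW n0')) expr2.
move: nS'; rewrite /S ler_pdivrMr ?mulr_gt0// => nS'.
have := ler_wpM2r (sqrtr_ge0 n%:R) nS'.
move: (Num.sqrt n%:R) (ln rho) => x y; lra.
Unshelve. all: by end_near. Qed.

End Growth.

(** * Newton's identities and bounded power sums *)

Section PowerSums.
Context {R : realType}.
Implicit Types (s : seq R[i]).

(** With [Q] the reversed product and [p_k] the power sums, this is [Q' / Q = - sum_k p_(k+1) X^k],
    truncated modulo ['X^M] to stay among polynomials. *)
Lemma newton_truncated (C : comNzRingType) (s : seq C) M : exists W : {poly C},
  (\prod_(a <- s) (1 - a *: 'X))^`()
    + \prod_(a <- s) (1 - a *: 'X) * \poly_(k < M) (\sum_(a <- s) a ^+ k.+1)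
  = 'X^M * W.
Proof.
elim: s => [|a s [W IH]].
  exists 0; rewrite big_nil -polyC1 derivC add0r mulr0 polyC1 mul1r.
  by apply/polyP => i; rewrite coef_poly coef0 big_nil if_same.
set Q := \prod_(b <- s) _ in IH; set H := \poly_(k < M) _ in IH.
pose G : {poly C} := \poly_(k < M) a ^+ k.+1.
have GE : (1 - a *: 'X) * G = a%:P - (a ^+ M.+1) *: 'X^M.
  apply/polyP => i; rewrite mulrBl mul1r -scalerAl coefB coefZ coefXM !coef_poly.
  rewrite coefB coefC coefZ coefXn.
  case: i => [|i] /=.
    by case: M {IH H G} => [|M]; rewrite ?expr1 ?mulr0 ?mulr1 ?subr0//= subrr.
  rewrite sub0r; case: (ltngtP i.+1 M) => iM.
  - by rewrite mulr0 oppr0 -exprS subrr.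
  - by rewrite !mulr0 subrr oppr0.
  - by rewrite mulr1 -iM -exprS sub0r.
exists ((1 - a *: 'X) * W - (a ^+ M.+1) *: Q).
rewrite !big_cons -/Q derivM.
have -> : \poly_(k < M) (\sum_(b <- a :: s) b ^+ k.+1) = G + H.
  apply/polyP => i; rewrite coefD !coef_poly big_cons; case: ltnP => // _.
  by rewrite addr0.
have -> : (1 - a *: 'X)^`() = - a%:P.
  by rewrite derivB derivZ derivX -polyC1 derivC sub0r alg_polyC.
have -> : 'X^M * ((1 - a *: 'X) * W - a ^+ M.+1 *: Q) =
  (1 - a *: 'X) * ('X^M * W) - Q * (a ^+ M.+1 *: 'X^M).
  by rewrite -!mul_polyC; ring.
rewrite -IH; move: GE.
move: (1 - a *: 'X) => L GE.
have -> : a ^+ M.+1 *: 'X^M = a%:P - L * G by rewrite GE opprB addrC subrK.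
ring.
Qed.

(** Up to a power of [z], the reversed product at [z] is the original one at [z^-1]. *)
Lemma reversed_prod_le s B :
  (forall z, normc z = 1 -> normc (\prod_(a <- s) ('X - a%:P)).[z] <= B) ->
  forall z, normc z = 1 -> normc (\prod_(a <- s) (1 - a *: 'X)).[z] <= B.
Proof.
move=> sB z z1; have z0 := circle_neq0 z1.
have zV1 : normc z^-1 = 1 by rewrite normcV z1 invr1.
rewrite (le_trans _ (sB _ zV1))// !horner_prod !normc_prod le_eqVlt.
apply/orP/or_introl/eqP/eq_bigr => a _.
rewrite -polyC1 !hornerE -[LHS]mul1r -{1}zV1 -normcM mulrBr mulr1 mulrCA mulVf//.
by rewrite mulr1.
Qed.

(** The constant is chosen before [s]: each power sum is determined by the earlier ones and by
    coefficients of the reversed product, all at most [B]. *)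
Lemma power_sum_bounded (B : R) m : exists C, forall s,
  (forall z, normc z = 1 -> normc (\prod_(a <- s) ('X - a%:P)).[z] <= B) ->
  forall k, (k < m)%N -> normc (\sum_(a <- s) a ^+ k.+1) <= C.
Proof.
elim: m => [|m [C IH]]; first by exists 0.
exists (Num.max C (m.+1%:R * B + \sum_(i < m) B * C)) => s sB k.
rewrite ltnS leq_eqVlt => /predU1P[->{k}|km]; last by rewrite le_max IH.
rewrite le_max; apply/orP; right.
set Q := \prod_(a <- s) (1 - a *: 'X).
have QB j : normc Q`_j <= B by apply: normc_coef_le; exact: reversed_prod_le.
have Q0 : Q`_0 = 1.
  rewrite -horner_coef0 horner_prod big1// => a _.
  by rewrite -polyC1 hornerD hornerN hornerZ hornerX hornerC mulr0 subr0.
(* The coefficient of ['X^m] gives [(m + 1) Q_(m+1) + p_(m+1) + sum_(i < m) Q_(i+1) p_(m-i) = 0]. *)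
have [W] := newton_truncated s m.+1; rewrite -/Q => /(congr1 (fun p : {poly _} => p`_m)).
rewrite coefD coef_deriv coefXnM ltnSn coefM big_ord_recl/= Q0 mul1r subn0.
rewrite coef_poly ltnSn => /eqP; rewrite addrCA addr_eq0 => /eqP ->.
rewrite normcN (le_trans (le_normcD _ _))// lerD//.
  by rewrite -[_`_m.+1 *+ _]mulr_natl normcM normc_nat ler_wpM2l.
rewrite (le_trans (normc_sum _ _ _))//; apply: ler_sum => i _.
have im := ltn_ord i; rewrite normcM ler_pM ?normc_ge0//= /bump leq0n coef_poly.
by rewrite ifT; [apply: IH => //; lia | lia].
Qed.

End PowerSums.

(** * Approximation on the circle by Fejer kernels *)

Section Fejer.
Context {R : realType}.
Implicit Types (t z w : R[i]).

Lemma sqr_normcD z w :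
  normc (z + w) ^+ 2 = normc z ^+ 2 + normc w ^+ 2 + 2 * complex.Re (w * (z^*)%C).
Proof. by rewrite !sqr_normcE; case: z => a b; case: w => c d; simpc => /=; ring. Qed.

(** [G] is [D + 2 sum_(0 < k < D) (D - k) X^k]; taking the real part on the circle replaces the
    negative powers. *)
Lemma fejer_poly D : exists G : {poly R[i]},
  [/\ (size G <= D)%N, G`_0 = D%:R &
    forall t, normc t = 1 -> complex.Re G.[t] = normc (\sum_(k < D) t ^+ k) ^+ 2].
Proof.
elim: D => [|D [G [sG G0 GE]]].
  exists 0; rewrite size_poly0 coef0; split => // t _.
  by rewrite horner0 big_ord0 normc0 expr0n.
pose H : {poly R[i]} := \sum_(k < D) ('X^(k.+1) *+ 2).
exists (G + 1 + H); split.
- rewrite (leq_trans (size_polyD _ _))// geq_max; apply/andP; split.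
    rewrite (leq_trans (size_polyD _ _))// geq_max size_poly1 ltnS leq0n andbT.
    exact: leqW.
  rewrite (leq_trans (size_sum _ _ _))//; apply/bigmax_leqP => k _.
  by rewrite mulr2n (leq_trans (size_polyD _ _))// maxnn size_polyXn ltnS.
- rewrite !coefD coef_sum G0 coef1 big1 ?addr0 ?natr1// => k _.
  by rewrite coefMn coefXn mul0rn.
move=> t t1; rewrite big_ord_recr/= sqr_normcD normcX t1 !expr1n.
rewrite -GE// !hornerD !complexReD hornerC/= horner_sum; congr (_ + _).
rewrite Re_sum [in RHS]rmorph_sum mulr_sumr Re_sum mulr_sumr (reindex_inj rev_ord_inj)/=.
apply: eq_bigr => k _; rewrite hornerMn hornerXn mulr2n complexReD.
have kD := ltn_ord k.
have -> : t ^+ D * (t ^+ k)^*%C = t ^+ (D - k).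
  rewrite -{1}(subnK (ltnW kD)) exprD -mulrA rmorphXn/= -exprMn mulcJ_normc t1.
  by rewrite !expr1n mulr1.
by rewrite -mulr2n mulr_natl subnSK.
Qed.

(** Geometric summation: the sum times [t - 1] is [t ^+ D - 1]. *)
Lemma fejer_kernel_le D t d : 0 < d -> normc t = 1 -> d <= normc (t - 1) ->
  normc (\sum_(k < D) t ^+ k) ^+ 2 <= 4 / d ^+ 2.
Proof.
move=> d0 t1 dt; have d20 : 0 < d ^+ 2 by rewrite exprn_gt0.
rewrite ler_pdivlMr// -exprMn.
have h : normc (\sum_(k < D) t ^+ k) * d <= 2.
  rewrite (le_trans (ler_wpM2l (normc_ge0 _) dt))// -normcM mulrC -subrX1.
  by rewrite (le_trans (le_normcD _ _))// normcN normcX t1 expr1n normc1.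
have -> : 4 = 2 ^+ 2 :> R by rewrite expr2 -natrM.
by rewrite ler_pXn2r ?nnegrE ?mulr_ge0 ?normc_ge0// ltW.
Qed.

(* Fejer interpolation: the Fejer kernel of order [D], centred at the [D]-th
   roots of unity, is a partition of unity on the circle. *)
Lemma fejer_approx (u : R[i] -> R) (U e d : R) : 0 < e -> 0 < d ->
  (forall z, normc z = 1 -> `|u z| <= U) ->
  (forall z w, normc z = 1 -> normc w = 1 -> normc (z - w) < d -> `|u z - u w| <= e) ->
  exists q : {poly R[i]}, forall z, normc z = 1 ->
    `|u z - complex.Re q.[z]| <= e *+ 2.
Proof.
move=> e0 d0 uU ud.
have U0 : 0 <= U by rewrite (le_trans _ (uU 1 (normc1 _))).
(* With this order a node at distance at least [d] contributes at most
   [8 U / (d n) ^ 2 <= e / n]. *)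
have [D DE] : exists D : nat, 8 * U / d ^+ 2 / e <= D.+1%:R.
  exists (Num.truncn (8 * U / d ^+ 2 / e)).
  by rewrite ltW// truncnS_gt.
have [w pw] := @prim_root_complex R D.+1 isT.
have w1 j : normc (w ^+ j) = 1 by rewrite normcX (normc_prim_root pw) expr1n.
have [G [sG G0 GE]] := fejer_poly D.+1.
set n : R := D.+1%:R in DE; have n0 : 0 < n by rewrite ltr0n.
(* The kernel centred at the node [(w ^+ j)^-1], normalised to total weight [1]. *)
pose F j z := normc (\sum_(k < D.+1) (z * w ^+ j) ^+ k) ^+ 2 / n ^+ 2.
have F_ge0 j z : 0 <= F j z by rewrite divr_ge0// sqr_ge0.
have n20 : 0 < n ^+ 2 by rewrite exprn_gt0.
have zw1 z j : normc z = 1 -> normc (z * w ^+ j) = 1.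
  by move=> z1; rewrite normcM w1 z1 mulr1.
have sumF z : normc z = 1 -> \sum_(j < D.+1) F j z = 1.
  move=> z1; rewrite -mulr_suml; apply: (canLR (mulfK (lt0r_neq0 n20))).
  under eq_bigr => j _ do rewrite -GE ?zw1//.
  rewrite mul1r -Re_sum.
  have sGz : (size (G \Po (z *: 'X)) <= D.+1)%N.
    rewrite (leq_trans (size_comp_poly_leq _ _))// ltnS.
    have zX : ((size (z *: 'X)%R).-1 <= 1)%N.
      by rewrite -subn1 leq_subLR (leq_trans (size_scale_leq _ _))// size_polyX.
    rewrite (leq_trans (leq_mul (leqnn _) zX))// muln1 -subn1 leq_subLR add1n.
    exact: sG.
  (* As [G] has size at most [n], the sum over the roots of unity is [n] times its constant
     coefficient, that is [n ^ 2]. *)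
  have := dft_coef pw sGz (ltn0Sn D); rewrite subn0 -horner_coef0 horner_comp.
  rewrite hornerZ hornerX mulr0 horner_coef0 G0 => E.
  rewrite (eq_bigr (fun j : 'I_D.+1 => (G \Po (z *: 'X)).[w ^+ j] * (w ^+ j) ^+ D.+1)).
    by rewrite E -natrM -(rmorph_nat (real_complex R))/= expr2 natrM.
  move=> j _; rewrite horner_comp hornerZ hornerX exprAC (prim_expr_order pw).
  by rewrite expr1n mulr1.
exists (\sum_(j < D.+1) (u (w ^+ j)^-1 / n ^+ 2)%:C%C *: (G \Po (w ^+ j *: 'X))).
move=> z z1.
have -> : complex.Re (\sum_(j < D.+1) (u (w ^+ j)^-1 / n ^+ 2)%:C%C *:
    (G \Po (w ^+ j *: 'X))).[z] = \sum_(j < D.+1) u (w ^+ j)^-1 * F j z.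
  rewrite horner_sum Re_sum; apply: eq_bigr => j _.
  rewrite hornerZ horner_comp hornerZ hornerX Re_realM [_ * z]mulrC GE ?zw1//.
  by rewrite /F [RHS]mulrA [LHS]mulrAC.
rewrite -[u z]mul1r -(sumF z z1) mulr_suml -sumrB.
rewrite (le_trans (ler_norm_sum _ _ _))//.
(* Near nodes are charged [e] times their weight, far ones [e / n] each. *)
rewrite (@le_trans _ _ (\sum_(j < D.+1) (F j z * e + e / n)))//; last first.
  rewrite big_split/= -mulr_suml sumF// mul1r sumr_const card_ord.
  by rewrite -[e / n *+ _]mulr_natr divfK ?gt_eqF// mulr2n.
apply: ler_sum => j _; rewrite [u _ * F j z]mulrC -mulrBr normrM ger0_norm//.
have v1 : normc (w ^+ j)^-1 = 1 by rewrite normcV w1 invr1.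
have [zd|zd] := ltP (normc (z - (w ^+ j)^-1)) d.
  by rewrite (le_trans (ler_wpM2l (F_ge0 j z) (ud _ _ z1 v1 zd)))// lerDl divr_ge0// ltW.
rewrite (@le_trans _ _ (e / n))//; last by rewrite lerDr mulr_ge0// ltW.
have u2 : `|u z - u (w ^+ j)^-1| <= 2 * U.
  by rewrite (le_trans (ler_normB _ _))// mulr_natl mulr2n lerD// uU.
have Fle : F j z <= 4 / d ^+ 2 / n ^+ 2.
  rewrite ler_wpM2r ?invr_ge0 ?(ltW n20)// fejer_kernel_le ?zw1//.
  rewrite (le_trans zd)// le_eqVlt; apply/orP; left; apply/eqP.
  rewrite -[LHS]mulr1 -(w1 j) -normcM mulrBl mulVf// circle_neq0//.
rewrite (le_trans (ler_pM (F_ge0 _ _) (normr_ge0 _) Fle u2))//.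
rewrite -(ler_pM2r n20) mulrAC divfK ?gt_eqF// [n ^+ 2]expr2 [e / n * _]mulrA divfK ?gt_eqF//.
move: DE; rewrite ler_pdivrMr// [n * e]mulrC => DE; apply: le_trans DE.
by rewrite le_eqVlt; apply/orP; left; apply/eqP; ring.
Qed.

End Fejer.

(** * Continuity, compactness and measurability in the complex plane *)

Section Topology.
Context {R : realType}.
Implicit Types (z w : R[i]).

Lemma complex_normE z : `|z| = ((normc z)%:C)%C.
Proof. by case: z. Qed.

Lemma near_normc z (e : R) : 0 < e -> \forall w \near z, normc (z - w) < e.
Proof.
move=> e0; have /cvgrPdist_lt /(_ (e%:C)%C) := @cvg_id _ (nbhs z).
rewrite ltcR => /(_ e0); apply: filterS => w.
by rewrite complex_normE ltcR.
Qed.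

(** Balls of [R[i]] have radii in [R[i]]; a positive radius is real in its partial order. *)
Lemma nbhs_normc z (P : set R[i]) : nbhs z P ->
  exists2 d : R, 0 < d & forall w, normc (z - w) < d -> P w.
Proof.
move=> /nbhs_ballP[eps /= eps0 epsP].
have epsE : eps = ((complex.Re eps)%:C)%C by rewrite RRe_real// gtr0_real.
exists (complex.Re eps) => [|w zw]; first by move: eps0; rewrite epsE ltcR.
by apply: epsP; rewrite -ball_normE/= epsE complex_normE ltcR.
Qed.

Lemma continuous_complexP (f : R[i] -> R) : continuous f <->
  forall z (e : R), 0 < e -> \forall w \near z, `|f z - f w| < e.
Proof.
split=> [cf z e e0|H z].
  by have /(@cvgrPdist_lt _ _ _ (nbhs z) (nbhs_filter z)) := cf z; exact.
by apply/(@cvgrPdist_lt _ _ _ (nbhs z) (nbhs_filter z)) => e; exact: H.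
Qed.

Lemma continuous_Re : continuous (@complex.Re R).
Proof.
apply/continuous_complexP => z e e0.
apply: (@filterS _ _ (nbhs_filter z) _ _ _ (near_normc z e0)) => w.
apply: le_lt_trans; case: z w => a b [c d].
exact: (le_Re_normc ((a +i* b) - (c +i* d))%C).
Qed.

Lemma continuous_Im : continuous (@complex.Im R).
Proof.
apply/continuous_complexP => z e e0.
apply: (@filterS _ _ (nbhs_filter z) _ _ _ (near_normc z e0)) => w.
apply: le_lt_trans; case: z w => a b [c d].
exact: (le_Im_normc ((a +i* b) - (c +i* d))%C).
Qed.

Lemma continuous_horner_complex (p : {poly R[i]}) : continuous (horner p).
Proof.
suff : continuous (horner p : R[i]^o -> R[i]^o) by [].
elim/poly_ind : p => [|p c IH] z.
  rewrite (_ : horner 0 = cst 0); last by apply/funext => x; rewrite horner0.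
  by apply: cvg_cst; exact: nbhs_filter.
rewrite (_ : horner _ = fun x => p.[x] * x + c); last first.
  by apply/funext => x; rewrite hornerMXaddC.
apply: (@cvgD R[i] R[i]^o _ (nbhs (z : R[i]^o))).
  by apply: (@cvgM R[i] _ (nbhs (z : R[i]^o)) _ (horner p) id); [exact: IH|exact: cvg_id].
by apply: cvg_cst; exact: nbhs_filter.
Qed.

(** Uniform continuity with only [z] on the circle: [cis] transports the compactness of [[0, 2 pi]],
    with [d] tending to [0] from the right as covering parameter. *)
Lemma continuous_near_circle (f : R[i] -> R) (e : R) : continuous f -> 0 < e ->
  exists2 d : R, 0 < d & forall z w, normc z = 1 -> normc (z - w) < d ->
    `|f z - f w| <= e.
Proof.
move=> cf e0; have e2 : 0 < e / 2 by rewrite divr_gt0.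
have /compact_near_coveringP cov := @segment_compact R 0 (2 * pi).
have near_d : \forall d \near (0 : R)^'+, `[0, 2 * pi] `<=`
    (fun t => forall w, normc (cis t - w) < d -> `|f (cis t) - f w| <= e).
  apply: cov => t _.
  have /continuous_complexP /(_ (cis t) _ e2) /nbhs_normc[d d0 dP] := cf.
  have d2 : 0 < d / 2 by rewrite divr_gt0.
  near=> t' d' => w /= tw.
  have t1 : normc (cis t - cis t') < d / 2.
    by near: t'; apply: (continuous_cis (near_normc (cis t) d2)).
  have t2 : d' <= d / 2 by near: d'; exact: nbhs_right_le.
  have h1 : `|f (cis t) - f (cis t')| < e / 2.
    by apply: dP; rewrite (lt_trans t1)// ltr_pdivrMr// ltr_pMr// ltr1n.
  have h2 : `|f (cis t) - f w| < e / 2.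
    apply: dP; rewrite -(subrKA (cis t')) (le_lt_trans (le_normcD _ _))//.
    by rewrite [d]splitr ltrD// (lt_le_trans tw).
  rewrite -(subrKA (f (cis t))) (le_trans (ler_normD _ _))// [e]splitr lerD// ltW//.
  by rewrite distrC.
near (0 : R)^'+ => d; exists d => [|z w]; first exact: (near (nbhs_right_gt 0) d).
move=> /cis_surj[t t0 <-]; apply: (near near_d d) => //=.
Unshelve. all: by end_near. Qed.

(** The support is covered with the bound [n] as a parameter tending to infinity; elsewhere [f] is
    zero. *)
Lemma bounded_of_compact_support (f : R[i] -> R[i]) : continuous f ->
  compact (closure [set z | f z != 0]) -> exists U, forall z, normc (f z) <= U.
Proof.
move=> cf /compact_near_coveringP cov.
have [|N _ NP] := cov _ \oo (fun n z => normc (f z) <= n%:R) _.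
  move=> z _; near=> w n => /=.
  have h1 : normc (f z - f w) < 1 by near: w; exact: cf (near_normc (f z) ltr01).
  have h2 : normc (f z) + 1 <= n%:R by near: n; exact: nbhs_infty_ger.
  rewrite (le_trans _ h2)// -lerBlDl (le_trans (le_dist_normc _ _))//.
  by rewrite normc_distC ltW.
exists N%:R => z; have [->|fz] := eqVneq (f z) 0; first by rewrite normc0.
by apply: NP => /=; [|exact: subset_closure].
Unshelve. all: by end_near. Qed.

Lemma continuous_measurable_complex (f : R[i] -> R) : continuous f ->
  measurable_fun setT f.
Proof.
move=> /continuousP cf; apply: (measurability _ (RGenOpens.measurableE R)).
move=> _ [_ [a [b ->] <-]]; rewrite setTI.
by apply: sub_sigma_algebra; apply: cf; exact: interval_open.
Qed.

End Topology.

(** * Averages of test functions over the zeros *)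

Section ZeroMean.
Context {R : realType}.
Implicit Types (s : seq R[i]) (q : {poly R[i]}).

Definition mean n (s : seq R[i]) (u : R[i] -> R) : R := n%:R^-1 * \sum_(a <- s) u a.

Lemma horner_bound2 q : exists H : R, forall z, normc z <= 2 -> normc q.[z] <= H.
Proof.
exists (\sum_(i < size q) normc q`_i * 2 ^+ i) => z z2.
rewrite horner_coef (le_trans (normc_sum _ _ _))//; apply: ler_sum => i _.
by rewrite normcM normcX ler_wpM2l ?normc_ge0// lerXn2r ?nnegrE ?normc_ge0.
Qed.

Lemma sum_near_circle_le (h : R[i] -> R) (e H r : R) s :
  0 <= e -> 0 <= H ->
  (forall z, z \in s -> `|h z| <= H) ->
  (forall z, r < normc z -> normc z < r^-1 -> `|h z| <= e) ->
  `|\sum_(a <- s) h a| <= e *+ size s +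
     H *+ (count (fun a => normc a <= r) s + count (fun a => r^-1 <= normc a) s).
Proof.
move=> e0 H0 hH he; rewrite (le_trans (ler_norm_sum _ _ _))//.
elim: s hH => [|a s IH] hH; first by rewrite big_nil !mulr0n addr0.
rewrite big_cons /= addnACA mulrnDr mulrS addrACA lerD//; last first.
  by apply: IH => z zs; apply: hH; rewrite inE zs orbT.
have Ha : `|h a| <= H by apply: hH; rewrite inE eqxx.
have [ar|ra] := leP (normc a) r.
  by rewrite (le_trans Ha)// mulrnDr addrCA lerDl addr_ge0// mulrn_wge0.
have [ar'|ra'] := leP r^-1 (normc a).
  by rewrite (le_trans Ha)// mulr1n lerDr.
by rewrite mulr0n addr0 he.
Qed.

(** Apart from its constant term, [q] contributes a fixed combination of power sums, however many
    points there are. *)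
Lemma sum_Re_horner_le q s C :
  (forall k, (k < size q)%N -> normc (\sum_(a <- s) a ^+ k.+1) <= C) ->
  `|\sum_(a <- s) complex.Re q.[a] - complex.Re q`_0 *+ size s|
     <= \sum_(i < size q) normc q`_i.+1 * C.
Proof.
move=> sC; rewrite -Re_sum.
have -> : \sum_(a <- s) q.[a] = \sum_(i < (size q).+1) q`_i * \sum_(a <- s) a ^+ i.
  under eq_bigr do rewrite (horner_coef_wide _ (leqnSn _)).
  by rewrite exchange_big/=; apply: eq_bigr => i _; rewrite mulr_sumr.
rewrite big_ord_recl/= complexReD.
have -> : complex.Re (q`_0 * \sum_(a <- s) a ^+ 0) = complex.Re q`_0 *+ size s.
  rewrite (eq_bigr (fun=> 1)) => [|a _]; last exact: expr0.
  rewrite big_const_seq count_predT iter_addr_0 mulr_natr.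
  by elim: (size s) => [|n IH]; rewrite ?mulr0n// !mulrS complexReD IH.
rewrite addrC addKr (le_trans (le_Re_normc _))// (le_trans (normc_sum _ _ _))//.
by apply: ler_sum => i _; rewrite normcM ler_wpM2l ?normc_ge0// sC.
Qed.

Lemma continuous_Re_horner q : continuous (fun z => complex.Re q.[z]).
Proof.
move=> z; apply: (@continuous_comp _ _ _ (horner q) (@complex.Re R)).
  exact: continuous_horner_complex.
exact: continuous_Re.
Qed.

(** The circle average of [u] enters as an abstract [L], known only through polynomial approximants.
    On an annulus [u] is replaced by [Re q], the few zeros off it are negligible, and the power sums
    handle the mean of [Re q]. *)
Lemma cvg_mean_zeros (T : nat -> {poly R[i]}) (u : R[i] -> R) (U L : R) :
  (forall n, (1 <= n)%N -> weighted_chebyshev (@w1 R) n (T n)) ->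
  continuous u -> (forall z, `|u z| <= U) ->
  (forall (q : {poly R[i]}) (e : R),
    (forall z, normc z = 1 -> `|u z - complex.Re q.[z]| <= e) ->
    `|L - complex.Re q`_0| <= e) ->
  mean n (zeros (T n)) u @[n --> \oo] --> L.
Proof.
move=> hT cu uU uL; apply/cvgrPdist_le => e e0.
(* Budget: [2 e1] for [L], [4 e1] in the annulus, [e1] for the zeros off it, [e1] for the power
   sums. *)
pose e1 := e / 8; have e10 : 0 < e1 by rewrite divr_gt0.
have [q qu] : exists q : {poly R[i]}, forall z, normc z = 1 ->
    `|u z - complex.Re q.[z]| <= e1 *+ 2.
  have [d d0 dP] := continuous_near_circle cu e10.
  apply: (@fejer_approx _ u U e1 d) => // z w z1 _.
  exact: dP.
have [d1 d10 d1P] := continuous_near_circle cu e10.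
have [d2 d20 d2P] := continuous_near_circle (@continuous_Re_horner q) e10.
pose d := Num.min d1 d2; have d0 : 0 < d by rewrite lt_min d10.
(* Since [1 - d < 1 / (1 + d)], the annulus between [r] and [1 / r] lies within [d] of the
   circle. *)
pose r := (1 + d)^-1; have d10' : 0 < 1 + d by rewrite addr_gt0.
have r0 : 0 < r by rewrite invr_gt0.
have r1 : r < 1 by rewrite invf_lt1// ltrDl.
have [H0 H0P] := horner_bound2 q.
have H00 : 0 <= H0 by rewrite (le_trans _ (H0P 0 _)) ?normc_ge0 ?normc0.
have U0 : 0 <= U by rewrite (le_trans _ (uU 0)).
pose h z := u z - complex.Re q.[z].
have hH z : normc z <= 2 -> `|h z| <= U + H0.
  move=> z2; rewrite (le_trans (ler_normB _ _))// lerD//.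
  by rewrite (le_trans (le_Re_normc _))// H0P.
(* Through the radial projection [z']: [e1] for [u], [2 e1] on the circle, [e1] for [q]. *)
have he z : r < normc z -> normc z < r^-1 -> `|h z| <= e1 *+ 4.
  move=> rz zr; have z0 : 0 < normc z by rewrite (lt_trans r0).
  pose z' := z * ((normc z)^-1%:C)%C.
  have z'1 : normc z' = 1.
    by rewrite normcM normc_real gtr0_norm ?invr_gt0// divff ?gt_eqF.
  have zd : normc (z' - z) < d.
    have -> : z' - z = z' * (1 - (normc z)%:C)%C.
      rewrite mulrBr mulr1 -mulrA -rmorphM/= mulVf ?gt_eqF//.
      by rewrite mulr1.
    rewrite normcM z'1 mul1r -(rmorph1 (real_complex R)) -rmorphB normc_real.
    rewrite invrK in zr; rewrite ltr_norml.
    have : 1 - d < r.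
      rewrite /r -[ltRHS]mul1r ltr_pdivlMr//.
      have : 0 < d * d by rewrite mulr_gt0.
      lra.
    lra.
  have a1 : `|u z' - u z| <= e1 by apply: d1P => //; rewrite (lt_le_trans zd)// ge_min lexx.
  have a2 : `|complex.Re q.[z'] - complex.Re q.[z]| <= e1.
    by apply: d2P => //; rewrite (lt_le_trans zd)// ge_min lexx orbT.
  have a3 := qu _ z'1; move: a1 a2 a3; rewrite /h !mulr2n !mulrS mulr0n !ler_norml.
  lra.
have [C CP] := @power_sum_bounded R 2 (size q).
(* Power sums are bounded for [1 :: zeros (T n)]; removing the point [1] costs [1]. *)
pose A := \sum_(i < size q) normc q`_i.+1 * (C + 1).
pose m1 n := if n is 0%N then 0%N else count (fun a => normc a <= r) (zeros (T n)).
pose m2 n := if n is 0%N then 0%N else count (fun a => r^-1 <= normc a) (zeros (T n)).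
have rV1 : 1 < r^-1 by rewrite invf_gt1.
have cm1 : (m1 n)%:R / n%:R @[n --> \oo] --> (0 : R).
  apply: (cvg_log_count rV1) => -[//|n] _.
  by have := @count_zeros_small R n.+1 (T n.+1) isT (hT n.+1 isT) r r0 r1; exact.
have cm2 : (m2 n)%:R / n%:R @[n --> \oo] --> (0 : R).
  apply: (cvg_log_count rV1) => -[//|n] _.
  by have := @count_zeros_large R n.+1 (T n.+1) (hT n.+1 isT) r r0 r1; exact.
have bnd n : (0 < n)%N -> `|mean n (zeros (T n)) u - complex.Re q`_0| <=
    e1 *+ 4 + (U + H0) * ((m1 n)%:R / n%:R + (m2 n)%:R / n%:R) + A / n%:R.
  move=> n0; have hTn := hT n n0; have [mT sT _] := hTn.
  have n0' : 0 < n%:R :> R by rewrite ltr0n.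
  set s := zeros (T n); have ss : size s = n by exact: size_zeros.
  have b1 := @sum_near_circle_le h (e1 *+ 4) (U + H0) r s.
  have {}b1 := b1 (mulrn_wge0 _ (ltW e10)) (addr_ge0 U0 H00)
    (fun z zs => hH z (zeros_le2 hTn zs)) he.
  have b2 : `|\sum_(a <- s) complex.Re q.[a] - complex.Re q`_0 *+ size s| <= A.
    apply: sum_Re_horner_le => k kq.
    have sB z : normc z = 1 -> normc (\prod_(a <- 1 :: s) ('X - a%:P)).[z] <= 2.
      move=> z1; rewrite big_cons -zerosE// hornerM hornerXsubC.
      by rewrite (le_trans (le_weighted_norm _ z1))// (weighted_chebyshev_le2 hTn).
    have := CP (1 :: s) sB k kq; rewrite big_cons expr1n => CPk.
    rewrite -[X in normc X](addKr 1) addrC (le_trans (le_normcD _ _))//.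
    by rewrite normcN normc1 lerD2r.
  rewrite -(ler_pM2r n0') -{1}[n%:R](ger0_norm (ltW n0')) -normrM.
  have -> : (mean n s u - complex.Re q`_0) * n%:R =
      \sum_(a <- s) h a + (\sum_(a <- s) complex.Re q.[a] - complex.Re q`_0 *+ size s).
    rewrite mulrBl /mean mulrAC mulVf ?gt_eqF// mul1r ss mulr_natr addrA.
    by rewrite -big_split/=; congr (_ - _); apply: eq_bigr => a _; rewrite /h subrK.
  rewrite (le_trans (ler_normD _ _))// (le_trans (lerD b1 b2))//.
  move: (U + H0) => V; have nN0 := lt0r_neq0 n0'.
  rewrite [leRHS]mulrDl divfK// [(_ + V * _) * _]mulrDl -[V * _ * _]mulrA.
  rewrite [(_ + _ / _) * _]mulrDl !divfK// ss.
  rewrite /m1 /m2 /s; case: (n) n0 => // k _.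
  by rewrite -natrD !mulr_natr.
have LL : `|L - complex.Re q`_0| <= e1 *+ 2 by exact: uL.
have V0 : 0 < U + H0 + 1 by rewrite ltr_wpDl// addr_ge0.
near=> n.
have n0 : (0 < n)%N by near: n; exists 1%N.
have := bnd n n0.
have c1 : `|0 - (m1 n)%:R / n%:R| <= e1 / (U + H0 + 1) / 2.
  by near: n; move/cvgrPdist_le : cm1; apply; rewrite !divr_gt0.
have c2 : `|0 - (m2 n)%:R / n%:R| <= e1 / (U + H0 + 1) / 2.
  by near: n; move/cvgrPdist_le : cm2; apply; rewrite !divr_gt0.
have A0 : A / n%:R <= e1.
  rewrite ler_pdivrMr ?ltr0n// mulrC -ler_pdivrMr//.
  by near: n; exact: nbhs_infty_ger.
rewrite !sub0r !normrN in c1 c2.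
have {}c1 := le_trans (ler_norm _) c1; have {}c2 := le_trans (ler_norm _) c2.
have c3 : (U + H0) * ((m1 n)%:R / n%:R + (m2 n)%:R / n%:R) <= e1.
  rewrite (@le_trans _ _ ((U + H0) * (e1 / (U + H0 + 1))))//.
    by rewrite ler_wpM2l ?addr_ge0// [leRHS]splitr lerD.
  rewrite mulrA ler_pdivrMr// mulrC ler_pM2l//; lra.
move: LL A0 c3; rewrite !ler_norml !mulr2n !mulrS mulr0n (_ : e = 8 * e1).
  move: (_ / _) (_ * _) (mean _ _ _) => x y m; lra.
by rewrite /e1; field.
Unshelve. all: by end_near. Qed.

End ZeroMean.

(** * Integrals against the zero measures and the circle measure *)

Section Integrals.
Context {R : realType}.
Implicit Types (u : R[i] -> R).

Lemma ge0_integral_zero_measure n (p : {poly R[i]}) (g : R[i] -> \bar R) :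
  measurable_fun setT g -> (forall z, 0 <= g z)%E ->
  (\int[zero_measure n p]_z g z = (n%:R^-1)%:E * \sum_(a <- zeros p) g a)%E.
Proof.
move=> mg g0; rewrite /zero_measure ge0_integral_mscale//; congr (_ * _)%E.
rewrite ge0_integral_measure_sum// (big_nth 0) big_mkord.
by apply: eq_bigr => k _; rewrite integral_dirac// diracT mul1e.
Qed.

Lemma Rintegral_zero_measure n (p : {poly R[i]}) u : measurable_fun setT u ->
  \int[zero_measure n p]_z u z = mean n (zeros p) u.
Proof.
move=> mu; have mEu : measurable_fun setT (EFin \o u) by exact/measurable_EFinP.
rewrite /Rintegral integralE -[(fun x => (u x)%:E)]/(EFin \o u) funerpos funerneg.
rewrite !ge0_integral_zero_measure//; last 4 first.
- by apply/measurable_EFinP; exact: measurable_funrneg.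
- by move=> z; rewrite lee_fin funrneg_ge0.
- by apply/measurable_EFinP; exact: measurable_funrpos.
- by move=> z; rewrite lee_fin funrpos_ge0.
rewrite !sumEFin -!EFinM -EFinB/= -mulrBr -sumrB; congr (_ * _).
by apply: eq_bigr => a _; rewrite -[in RHS](funrposBneg u).
Qed.

Let P := uniform_prob (two_pi_gt0 R).

Let fine_PT : fine (P setT) = 1.
Proof. by rewrite [P _]probability_setT. Qed.

Lemma integrable_uniform (f : R -> R) M : continuous f -> (forall t, `|f t| <= M) ->
  P.-integrable setT (EFin \o f).
Proof.
move=> cf fM; apply: measurable_bounded_integrable => //.
- by rewrite /= [X in (X < _)%E]probability_setT ltry.
- exact: continuous_measurable_fun.
- exists M; split; first exact: num_real.
  by move=> x Mx t _; apply: le_trans (fM t) _; exact: ltW.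
Qed.

Lemma continuous_trig (a b : R) k :
  continuous (fun t : R => a * cos (t * k%:R) - b * sin (t * k%:R)).
Proof.
have ck : continuous (fun s : R => s * k%:R) by move=> t; exact: mulrr_continuous.
move=> t; apply: cvgB; apply: cvgM; try exact: cvg_cst.
  by apply: (@continuous_comp _ _ _ (fun s : R => s * k%:R) cos); [exact: ck|exact: continuous_cos].
by apply: (@continuous_comp _ _ _ (fun s : R => s * k%:R) sin); [exact: ck|exact: continuous_sin].
Qed.

Lemma trig_le (a b : R) k t :
  `|a * cos (t * k%:R) - b * sin (t * k%:R)| <= `|a| + `|b|.
Proof.
rewrite (le_trans (ler_normB _ _))// lerD// normrM ler_piMr// ?cos_max//.
exact: sin_max.
Qed.

Lemma Rintegral_uniform_trig (a b : R) k : (0 < k)%N ->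
  \int[P]_t (a * cos (t * k%:R) - b * sin (t * k%:R)) = 0.
Proof.
move=> k0; pose f t := a * cos (t * k%:R) - b * sin (t * k%:R).
(* Adding [M] makes the integrand nonnegative, so that the integral against the uniform law can be
   computed from the antiderivative [F] of [g]. *)
pose M := `|a| + `|b|; pose g t := f t + M.
pose F t := (a * sin (t * k%:R) + b * cos (t * k%:R)) / k%:R + M * t.
have kN0 : k%:R != 0 :> R by rewrite pnatr_eq0 -lt0n.
have f_le t : `|f t| <= M by exact: trig_le.
have dk (t : R) : is_derive t (1 : R) (fun s : R => s * k%:R) k%:R.
  have := is_deriveZ k%:R (is_derive_id t (1 : R)).
  rewrite /GRing.scale/= mulr1; congr is_derive.
  by apply/funext => s; rewrite /= mulrC.
have dF (t : R) : is_derive t (1 : R) F (g t).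
  have ds := @is_derive1_comp _ sin (fun s : R => s * k%:R) t _ _ (is_derive_sin (t * k%:R)) (dk t).
  have dc := @is_derive1_comp _ cos (fun s : R => s * k%:R) t _ _ (is_derive_cos (t * k%:R)) (dk t).
  have Fa := is_deriveD (is_deriveZ a ds) (is_deriveZ b dc).
  have FM := is_deriveZ M (is_derive_id t (1 : R)).
  have -> : F = (k%:R^-1 \*: (a \*: (sin \o (fun s => s * k%:R)) +
      b \*: (cos \o (fun s => s * k%:R)))) + M \*: id.
    by apply/funext => s; rewrite /F mulrC.
  apply: (is_derive_eq (is_deriveD (is_deriveZ k%:R^-1 Fa) FM)).
  by rewrite /g /f /GRing.scale/=; field.
have cf : continuous f by exact: continuous_trig.
have cg : continuous g by move=> t; apply: cvgD; [exact: cf|exact: cvg_cst].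
have g0 t : 0 <= g t by have := f_le t; rewrite ler_norml => /andP[h _]; rewrite /g -lerBlDr sub0r.
have cF : continuous F.
  by move=> t; apply: differentiable_continuous; apply/derivable1_diffP; exact: ex_derive.
have p20 := two_pi_gt0 R.
have Ig : (\int[P]_t (g t)%:E = M%:E)%E.
  rewrite integral_uniform; last 2 first.
  - by apply/measurable_EFinP; exact: continuous_measurable_fun.
  - by move=> t; rewrite lee_fin.
  rewrite (@continuous_FTC2 _ g F 0 (2 * pi))//.
  - rewrite -EFinB -EFinM; congr EFin; rewrite /F subr0.
    have -> : 2 * pi * k%:R = pi *+ 2 *+ k :> R.
      by rewrite -mulrnA -[RHS]mulr_natr natrM mulrA [pi * 2]mulrC.
    have c1 : cos (pi *+ 2 *+ k) = 1 :> R.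
      by rewrite -[_ *+ k]add0r (periodicn (@cosD2pi R)) cos0.
    have s1 : sin (pi *+ 2 *+ k) = 0 :> R.
      by rewrite -[_ *+ k]add0r (periodicn (@sinD2pi R)) sin0.
    rewrite c1 s1 !mul0r cos0 sin0; move: p20; move: (2 * pi) => p p0.
    by field; rewrite kN0 gt_eqF.
  - exact: continuous_subspaceT.
  - split.
    + by move=> t _; exact: ex_derive.
    + by apply: cvg_at_right_filter; exact: cF.
    + by apply: cvg_at_left_filter; exact: cF.
  - by move=> t _; rewrite derive1E derive_val.
have iM : P.-integrable setT (EFin \o cst M).
  by apply: (@integrable_uniform _ `|M|) => // t; exact: cvg_cst.
have ig : P.-integrable setT (EFin \o g).
  apply: (@integrable_uniform _ (M + M)) => // t.
  by rewrite ger0_norm// lerD2r (le_trans (ler_norm _)).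
rewrite (_ : (fun t : R => _) = fun t => g t - cst M t); last first.
  by apply/funext => t; rewrite /g addrK.
rewrite RintegralB// {1}/Rintegral Ig Rintegral_cst//.
by rewrite fine_PT mulr1 subrr.
Qed.

(** The mean value property: only the constant trigonometric term survives integration. *)
Lemma Rintegral_uniform_horner (q : {poly R[i]}) :
  \int[P]_t complex.Re q.[cis t] = complex.Re q`_0.
Proof.
pose f k t : R := complex.Re q`_k * cos (t * k%:R) - complex.Im q`_k * sin (t * k%:R).
have cf k : continuous (f k) by exact: continuous_trig.
have intf k : P.-integrable setT (EFin \o f k).
  apply: (@integrable_uniform _ (`|complex.Re q`_k| + `|complex.Im q`_k|)) => // t; exact: trig_le.
have fE t : complex.Re q.[cis t] = \sum_(k < (size q).+1) f k t.
  rewrite (horner_coef_wide _ (leqnSn _)) Re_sum; apply: eq_bigr => k _.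
  by rewrite complexReM -cisMn /cis/= -mulr_natr.
under eq_Rintegral do rewrite fE.
have sumf n : P.-integrable setT (EFin \o (fun t => \sum_(k < n.+1) f k t)) /\
    \int[P]_t (\sum_(k < n.+1) f k t) = complex.Re q`_0.
  elim: n => [|n [IH1 IH2]].
    rewrite (_ : (fun t => _) = f 0%N); last by apply/funext => t; rewrite big_ord1.
    split; first exact: intf.
    rewrite (_ : f 0%N = cst (complex.Re q`_0)); last first.
      by apply/funext => t; rewrite /f mulr0 cos0 sin0 mulr1 mulr0 subr0.
    by rewrite Rintegral_cst// fine_PT mulr1.
  rewrite (_ : (fun t => _) = fun t => \sum_(k < n.+1) f k t + f n.+1 t); last first.
    by apply/funext => t; rewrite big_ord_recr.
  split; last by rewrite RintegralD// IH2 Rintegral_uniform_trig// addr0.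
  by have := integrableD measurableT IH1 (intf n.+1).
exact: (sumf _).2.
Qed.

(** This is the assumption that [cvg_mean_zeros] makes on its limit [L]. *)
Lemma circle_integral_approx u U (q : {poly R[i]}) (e : R) :
  continuous u -> (forall z, `|u z| <= U) ->
  (forall z, normc z = 1 -> `|u z - complex.Re q.[z]| <= e) ->
  `|\int[circle_measure R]_z u z - complex.Re q`_0| <= e.
Proof.
move=> cu uU uq; have mu := continuous_measurable_complex cu.
have cuc : continuous (u \o @cis R).
  by move=> t; apply: continuous_comp; [exact: continuous_cis|exact: cu].
have iu : P.-integrable setT (EFin \o (u \o @cis R)).
  by apply: (@integrable_uniform _ U) => // t; exact: uU.
have cq : continuous (fun t : R => complex.Re q.[cis t]).
  move=> t; apply: (@continuous_comp _ _ _ (@cis R) (fun z => complex.Re q.[z])).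
    exact: continuous_cis.
  exact: continuous_Re_horner.
have iq : P.-integrable setT (EFin \o (fun t : R => complex.Re q.[cis t])).
  apply: (@integrable_uniform _ (e + U)) => // t.
  rewrite -[complex.Re _](subKr (u (cis t))) (le_trans (ler_normB _ _))// addrC lerD//.
  by rewrite uq// normc_cis.
have iuq : P.-integrable setT (EFin \o (fun t => u (cis t) - complex.Re q.[cis t])).
  apply: (@integrable_uniform _ e) => [t|t]; last by rewrite uq// normc_cis.
  by apply: cvgB; [exact: cuc|exact: cq].
have -> : \int[circle_measure R]_z u z = \int[P]_t u (cis t).
  rewrite /Rintegral /circle_measure integral_distribution//.
  exact/measurable_EFinP.
rewrite -Rintegral_uniform_horner -RintegralB//.
rewrite (le_trans (le_normr_Rintegral _ iuq))//.
rewrite (@le_trans _ _ (\int[P]_t (cst e t)))//.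
  apply: le_Rintegral => //.
  - exact: (integrable_norm iuq).
  - by apply: (@integrable_uniform _ `|e|) => // t; exact: cvg_cst.
  - by move=> t _; rewrite uq// normc_cis.
by rewrite Rintegral_cst// fine_PT mulr1.
Qed.

Lemma zero_measure_disc n (p : {poly R[i]}) r :
  zero_measure n p [set z : R[i] | normc z <= r] =
  ((count (fun a => normc a <= r) (zeros p))%:R / n%:R)%:E.
Proof.
rewrite /zero_measure /mscale/= /msum/= mulrC EFinM; congr (_ * _)%E.
rewrite -sum1_count (big_nth 0) big_mkord big_mkcond natr_sum -sumEFin.
apply: eq_bigr => k _; rewrite [LHS]diracE.
case: ifPn => h; first by rewrite mem_set.
by rewrite memNset//=; exact/negP.
Qed.

Lemma cvg_complex (a b : nat -> R) (x y : R) :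
  a n @[n --> \oo] --> x -> b n @[n --> \oo] --> y ->
  (a n +i* b n)%C @[n --> \oo] --> (x +i* y)%C.
Proof.
move=> /cvgrPdist_lt ax /cvgrPdist_lt bxy; apply/cvgrPdist_lt => e e0.
have eE : e = ((complex.Re e)%:C)%C by rewrite RRe_real// gtr0_real.
have e2 : 0 < complex.Re e / 2 by move: e0; rewrite eE ltcR => ?; rewrite divr_gt0.
near=> n.
have xa : `|x - a n| < complex.Re e / 2 by near: n; exact: ax.
have yb : `|y - b n| < complex.Re e / 2 by near: n; exact: bxy.
rewrite complex_normE eE ltcR [complex.Re e]splitr.
have -> : ((x +i* y) - (a n +i* b n) = (x - a n) +i* (y - b n))%C by [].
rewrite [((_ - _) +i* _)%C]complexE.
rewrite (le_lt_trans (le_normcD _ _))// ltrD//; first by rewrite normc_real.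
by rewrite normcM normc_real /normc/= expr0n expr1n add0r sqrtr1 mul1r.
Unshelve. all: by end_near. Qed.

End Integrals.

Theorem theorem3 (R : realType) (T : nat -> {poly R[i]})
    (hT : forall n : nat, (1 <= n)%N -> weighted_chebyshev (@w1 R) n (T n)) :
  (forall r : R, 0 < r -> r < 1 ->
     zero_measure n (T n) [set z : R[i] | normc z <= r] @[n --> \oo] --> 0%E)
  /\ weak_star_cvg (fun n => zero_measure n (T n)) (circle_measure R).
Proof.
split=> [r r0 r1|phi cphi sphi].
  (* The value at [0] is fixed by hand: nothing is assumed of [T 0], and the limit ignores it. *)
  pose m n := if n is 0%N then 0%N else count (fun a => normc a <= r) (zeros (T n)).
  have cm : (m n)%:R / n%:R @[n --> \oo] --> (0 : R).
    apply: (@cvg_log_count _ r^-1); first by rewrite invf_gt1.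
    by case=> // n _; have := @count_zeros_small R n.+1 (T n.+1) isT (hT n.+1 isT) r r0 r1; exact.
  have : ((m n)%:R / n%:R)%:E @[n --> \oo] --> (0 : R)%:E by apply: cvg_EFin => //; exact: nearW.
  apply: cvg_trans; apply: near_eq_cvg; near=> n.
  have n0 : (0 < n)%N by near: n; exists 1%N.
  by rewrite zero_measure_disc /m; case: (n) n0.
(* Compact support bounds [phi]; its real and imaginary parts are then treated separately. *)
have [U phiU] := bounded_of_compact_support cphi sphi.
have cRe : continuous (fun z => complex.Re (phi z)).
  move=> z; apply: (@continuous_comp _ _ _ phi (@complex.Re R)); first exact: cphi.
  exact: continuous_Re.
have cIm : continuous (fun z => complex.Im (phi z)).
  move=> z; apply: (@continuous_comp _ _ _ phi (@complex.Im R)); first exact: cphi.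
  exact: continuous_Im.
have URe z : `|complex.Re (phi z)| <= U by rewrite (le_trans (le_Re_normc _)).
have UIm z : `|complex.Im (phi z)| <= U by rewrite (le_trans (le_Im_normc _)).
have main (u : R[i] -> R) : continuous u -> (forall z, `|u z| <= U) ->
    \int[zero_measure n (T n)]_z u z @[n --> \oo] --> \int[circle_measure R]_z u z.
  move=> cu uU.
  under eq_fun do rewrite (Rintegral_zero_measure _ _ (continuous_measurable_complex cu)).
  by apply: (cvg_mean_zeros hT cu uU) => q e; exact: circle_integral_approx.
have cvRe := main _ cRe URe; have cvIm := main _ cIm UIm.
exact: cvg_complex cvRe cvIm.
Unshelve. all: by end_near. Qed.
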